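(* Let $k$ be a field and $R=k[x_1,\dots,x_n]$. If the morphism $R\xrightarrow{f}R$ (sending $1\mapsto f$, with $f\in R$) is computed by a colimit computation of cost $c$ in $R\text{-}\mathbf{Mod}$ with the basic morphisms listed below, then there is an arithmetic circuit with inputs $x_1,\dots,x_n$ of size $\mathrm{poly}(c)$ (at most a fixed polynomial in $c$) that computes $f$.
   Context: Basic morphisms in the category $R\text{-}\mathbf{Mod}$ of $R$-modules (each of unit cost): $R\xrightarrow{x_i}R$ for $i=1,\dots,n$; $R\xrightarrow{c}R$ for each $c\in k$; the inclusions $i_1,i_2:R\to R\oplus R$; the diagonal $\Delta:R\to R\oplus R$; the sum $+:R\oplus R\to R$; and $R\to\{0\}$. A diagram of finite shape $I=(V,E,s,t)$ assigns objects to vertices and morphisms $D(e):D(s(e))\to D(t(e))$ to edges (no commutativity required); subdiagrams are restrictions to full subgraphs. A colimit computation is a sequence of diagrams $(D_0,\dots,D_s)$ where $D_0$ consists only of basic morphisms and each $D_i$ ($i\ge1$) is obtained from $D_{i-1}$ by choosing a full subgraph $J_i$, adding a new vertex $v_i$ carrying a colimit of $D_{i-1}|_{J_i}$ and edges from each vertex of $J_i$ to $v_i$ carrying the colimit cocone morphisms, subject to constructivity: if $v_i$ lies in $J_j$ for some $j>i$ then $J_i\subseteq J_j$. It computes a diagram $D$ if $D$ is isomorphic to a not-necessarily-full subdiagram of $D_s$. Its cost is $s$ plus the number of edges of $D_0$. An arithmetic circuit over $k$ is a finite directed acyclic graph whose indegree-$0$ vertices are labeled by variables or elements of $k$ and other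 vertices by $+$ or $\times$; its size is the number of vertices; it computes $f$ if $f$ is the polynomial at some vertex. *)

(* Defs.v *)
From HB Require Import structures.
From mathcomp Require Import all_boot all_order all_algebra.
From mathcomp Require Import mpoly.
From Stdlib Require List.

Set Implicit Arguments.
Unset Strict Implicit.
Unset Printing Implicit Defensive.

Import GRing.Theory.
Local Open Scope ring_scope.

Section ColimitComputations.

Variables (k : fieldType) (n : nat).

Local Notation R := {mpoly k[n]}.

(* Free modules R^a are represented as row vectors 'rV[R]_a :
   R = 'rV_1, R (+) R = 'rV_2, {0} = 'rV_0. *)

Inductive basic : nat -> nat -> Type :=
  | BVar   of 'I_n : basic 1 1
  | BConst of k    : basic 1 1
  | BIncl1         : basic 1 2
  | BIncl2         : basic 1 2
  | BDiag          : basic 1 2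
  | BSum           : basic 2 1
  | BZero          : basic 1 0.

Definition basic_mx a b (e : basic a b) : 'M[R]_(a, b) :=
  match e in basic a b return 'M[R]_(a, b) with
  | BVar i   => ('X_i : R)%:M
  | BConst c => (c%:MP : R)%:M
  | BIncl1   => \matrix_(i < 1, j < 2) ((j == 0 :> nat)%:R : R)
  | BIncl2   => \matrix_(i < 1, j < 2) ((j == 1 :> nat)%:R : R)
  | BDiag    => const_mx 1
  | BSum     => const_mx 1
  | BZero    => 0
  end.

Definition basic_map a b (e : basic a b) : {linear 'rV[R]_a -> 'rV[R]_b} :=
  mulmxr (basic_mx e).

Definition edge (V : Type) (obj : V -> lmodType R) :=
  { p : V * V & {linear obj p.1 -> obj p.2} }.
Definition esrc V obj (e : @edge V obj) : V := (projT1 e).1.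
Definition etgt V obj (e : @edge V obj) : V := (projT1 e).2.
Definition emap V obj (e : @edge V obj) : obj (esrc e) -> obj (etgt e) :=
  projT2 e.

Definition is_cocone (V : finType) (obj : V -> lmodType R) (J : {set V})
    (E : seq (edge obj)) (L : lmodType R) (c : forall v, obj v -> L) :=
  forall e, List.In e E -> esrc e \in J -> etgt e \in J ->
    forall x, c (etgt e) (@emap _ _ e x) = c (esrc e) x.

Definition is_colimit (V : finType) (obj : V -> lmodType R) (J : {set V})
    (E : seq (edge obj)) (L : lmodType R)
    (c : forall v, {linear obj v -> L}) : Prop :=
  is_cocone J E (fun v => c v) /\
  forall (M : lmodType R) (d : forall v, {linear obj v -> M}),
    is_cocone J E (fun v => d v) ->
    exists h : {linear L -> M},
      (forall v, v \in J -> forall x, h (c v x) = d v x) /\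
      (forall h' : {linear L -> M},
         (forall v, v \in J -> forall x, h' (c v x) = d v x) ->
         forall y, h' y = h y).

(* Shape data of a colimit computation (D_0, ..., D_s):
   - m initial vertices (those of D_0); vertex u carries R^(ccdim u);
   - s steps; the vertex v_i added at step i carries the module ccL i. *)
Record ccShape := CCShape {
  ccm : nat;
  ccs : nat;
  ccdim : 'I_ccm -> nat;
  ccL : 'I_ccs -> lmodType R }.

(* Vertices of D_s: inl u = vertex u of D_0, inr i = vertex v_i. *)
Definition ccV (S : ccShape) : finType := ('I_(ccm S) + 'I_(ccs S))%type.

Definition ccobj (S : ccShape) (v : ccV S) : lmodType R :=
  match v with
  | inl u => 'rV[R]_(@ccdim S u)
  | inr i => @ccL S i
  end.

(* v is a vertex of D_{i} before step i (0-indexed: the step with index i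
   adds vertex inr i to the diagram obtained after steps 0..i-1). *)
Definition exists_before (S : ccShape) (i : nat) (v : ccV S) : bool :=
  match v with inl _ => true | inr j => (j < i)%N end.

Record colimComp := CC {
  ccS :> ccShape;
  ccE0 : seq {uv : 'I_(ccm ccS) * 'I_(ccm ccS) &
                   basic (@ccdim ccS uv.1) (@ccdim ccS uv.2)};
  ccJ : 'I_(ccs ccS) -> {set ccV ccS};
  (* cocone morphisms obj v -> v_i (only relevant for v in J_i) *)
  ccc : forall (i : 'I_(ccs ccS)) (v : ccV ccS),
          {linear ccobj v -> @ccL ccS i} }.

Section Edges.
Variable D : colimComp.

Definition E0_edges : seq (edge (@ccobj D)) :=
  [seq @existT _ (fun p : ccV D * ccV D => {linear ccobj p.1 -> ccobj p.2})
        (inl (projT1 e).1, inl (projT1 e).2) (basic_map (projT2 e))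
  | e <- ccE0 D].

Definition step_edges (j : 'I_(ccs D)) : seq (edge (@ccobj D)) :=
  [seq @existT _ (fun p : ccV D * ccV D => {linear ccobj p.1 -> ccobj p.2})
        (v, inr j) (ccc j v)
  | v <- enum (ccJ j)].

Definition edges_upto (i : nat) : seq (edge (@ccobj D)) :=
  E0_edges ++ flatten (map step_edges [seq j <- enum 'I_(ccs D) | (nat_of_ord j < i)%N]).

Definition final_edges := edges_upto (ccs D).

Definition cc_valid : Prop :=
  (* D_0 consists only of basic morphisms: every vertex of D_0 lies on an
     edge of D_0 (hence carries R, R (+) R or {0}) *)
  (forall u : 'I_(ccm D),
     has (fun e => ((projT1 e).1 == u) || ((projT1 e).2 == u)) (ccE0 D)) /\
  (forall i : 'I_(ccs D), {subset ccJ i <= exists_before i}) /\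
  (forall i : 'I_(ccs D),
     is_colimit (ccJ i) (edges_upto i) (ccc i)) /\
  (forall i j : 'I_(ccs D), (i < j)%N -> inr i \in ccJ j ->
     ccJ i \subset ccJ j).

Definition cc_cost : nat := (ccs D + size (ccE0 D))%N.

(* D computes the diagram R --f--> R (1 |-> f): it is isomorphic to a
   (not necessarily full) subdiagram of D_s, i.e. there is an edge
   u -> w of D_s, u <> w, and isomorphisms phi : R ~ obj u, psi : R ~ obj w
   with  D_s(e) o phi = psi o (f * -). *)
Definition cc_computes (f : R) : Prop :=
  exists e, List.In e final_edges /\ esrc e <> etgt e /\
  exists (phi : {linear 'rV[R]_1 -> ccobj (esrc e)})
         (psi : {linear 'rV[R]_1 -> ccobj (etgt e)}),
    bijective phi /\ bijective psi /\
    forall r : 'rV[R]_1, @emap _ _ e (phi r) = psi (r *m f%:M).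

End Edges.

(* Arithmetic circuits over k with inputs x_1..x_n, given as a list of
   vertices in a topological order; children are referenced by position. *)
Inductive gate :=
  | GVar   of 'I_n
  | GConst of k
  | GAdd   of seq nat
  | GMul   of seq nat.

(* Gate at position i: + / x vertices have indegree >= 1, distinct
   in-neighbours, all earlier in the order (so the graph is acyclic). *)
Definition gate_ok (i : nat) (g : gate) : bool :=
  match g with
  | GAdd s | GMul s => [&& s != [::], uniq s & all (fun j => (j < i)%N) s]
  | _ => true
  end.

Definition circuit_wf (gs : seq gate) : Prop :=
  forall i, (i < size gs)%N -> gate_ok i (nth (GConst 0) gs i).

Definition gate_val (vals : seq R) (g : gate) : R :=
  match g with
  | GVar i => 'X_i
  | GConst c => c%:MP
  | GAdd s => \sum_(j <- s) nth 0 vals j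
  | GMul s => \prod_(j <- s) nth 0 vals j
  end.

Definition circuit_values (gs : seq gate) : seq R :=
  foldl (fun vals g => rcons vals (gate_val vals g)) [::] gs.

Definition circuit_size (gs : seq gate) : nat := size gs.

End ColimitComputations.

(* Main.v *)
(* By constructivity, every module of the computation is the colimit of a part
   of the initial diagram: a quotient of R^G, for a set G of O(c) generators, by
   relations whose coefficients are affine forms a + b x_i. If it is isomorphic
   to R, the quotient map is a vector q of polynomials, and f is, up to a nonzero
   constant, an entry of such a vector, or a quotient q_g / p_g of entries of two
   of them with p_g(0) <> 0; the latter is a division of power series.

   It remains to compute q. Grade R by x_i -> t x_i. By the universal property
   for the R-module R[t], every vector over R[t] which satisfies the relations
   with x replaced by t x is a multiple of q(t x); hence Cramer's rule bounds the
   degree e of q, and the homogeneous components of the q_g span the solutions of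
   the linear system expressing the relations in degree <= e. Some q_g has a
   nonzero constant term, because q is onto; fixing it turns the system into a
   square one, T z = b, with det T <> 0. Strassen's division trick solves it: T
   is invertible at a point y of the curve (s^w_1, ..., s^w_n) with small
   exponents (this works over finite fields as well), so expanding around y only
   needs the constant matrix adj T(y) over k[s], and z has degree <= e. *)
Require Import Defs.
From HB Require Import structures.
From mathcomp Require Import all_boot all_order all_algebra.
From mathcomp Require Import perm generic_quotient mpoly zify.

Set Implicit Arguments.
Unset Strict Implicit.
Unset Printing Implicit Defensive.

Import GRing.Theory.
Local Open Scope ring_scope.

(** * Straight-line programs, their costs, and their conversion into circuits *)

Section StraightLinePrograms.

Variables (k : fieldType) (n : nat).
Local Notation R := {mpoly k[n]}.
Implicit Types (l F G : seq R) (a b p q : R) (t : nat).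

(* The list is read from its end: the head is the last element computed. *)
Fixpoint slp l : Prop :=
  if l is a :: l' then
    [\/ exists i, a = 'X_i, exists c, a = c%:MP
      | exists b c, [/\ b \in l', c \in l' & a = b + c \/ a = b * c]] /\ slp l'
  else True.

(** Quantifying over every program that contains [l] makes costs add up along a chain of extensions,
    each intermediate result being paid for once. *)
Definition reach l F t : Prop :=
  forall l1, slp l1 -> {subset l <= l1} ->
  exists l2, [/\ slp l2, {subset l1 <= l2}, {subset F <= l2}
               & (size l2 <= size l1 + t)%N].

Lemma reach_mem l F : {subset F <= l} -> reach l F 0.
Proof. by move=> sF l1 s1 sl1; exists l1; rewrite addn0; split=> // x /sF/sl1. Qed.

Lemma reachW l1 F1 t1 l2 F2 t2 : {subset l1 <= l2} -> {subset F2 <= F1} ->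
  (t1 <= t2)%N -> reach l1 F1 t1 -> reach l2 F2 t2.
Proof.
move=> sl sF le r l s sll; have [|l' [s' ss sF' sz]] := r l s.
  by move=> x /sl/sll.
exists l'; split=> //; first by move=> x /sF/sF'.
by apply: leq_trans sz _; rewrite leq_add2l.
Qed.

Lemma reach_le t1 l F t2 : (t1 <= t2)%N -> reach l F t1 -> reach l F t2.
Proof. exact: reachW. Qed.

Lemma reach_sub F1 l F2 t : {subset F2 <= F1} -> reach l F1 t -> reach l F2 t.
Proof. by move=> s; exact: reachW. Qed.

Lemma reach_base l1 l2 F t : {subset l1 <= l2} -> reach l1 F t -> reach l2 F t.
Proof. by move=> s; exact: reachW. Qed.

(** The results [F] are kept while [G] is computed; this is the form needed by recurrences, where
    all earlier terms stay in use. *)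
Lemma reach_bind l F G t u :
  reach l F t -> reach (F ++ l) G u -> reach l (F ++ G) (t + u).
Proof.
move=> rF rG l1 s1 sl; have [l2 [s2 s12 sF z2]] := rF _ s1 sl.
have [|l3 [s3 s23 sG z3]] := rG _ s2.
  by move=> x; rewrite mem_cat => /orP[/sF|/sl/s12].
exists l3; split=> //; first by move=> x /s12/s23.
  by move=> x; rewrite mem_cat => /orP[/sF/s23|/sG].
by rewrite addnA (leq_trans z3) ?leq_add2r.
Qed.

Lemma reach_cat l F G t u :
  reach l F t -> reach l G u -> reach l (F ++ G) (t + u).
Proof.
move=> rF rG; apply: reach_bind rF (reach_base _ rG).
by move=> x xl; rewrite mem_cat xl orbT.
Qed.

Lemma reach_trans l F G t u : reach l F t -> reach F G u -> reach l G (t + u).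
Proof.
move=> rF rG; apply: (@reach_sub (F ++ G)).
  by move=> x xl; rewrite mem_cat xl orbT.
by apply: reach_bind rF (reach_base _ rG) => x xl; rewrite mem_cat xl.
Qed.

Lemma reach_var l i : reach l [:: 'X_i] 1.
Proof.
move=> l1 s1 _; exists ('X_i :: l1); split=> //=; last by rewrite addn1.
- by split=> //; constructor 1; exists i.
- by move=> x; rewrite inE => ->; rewrite orbT.
- by move=> x; rewrite !inE => ->.
Qed.

Lemma reach_const l c : reach l [:: c%:MP] 1.
Proof.
move=> l1 s1 _; exists (c%:MP :: l1); split=> //=; last by rewrite addn1.
- by split=> //; constructor 2; exists c.
- by move=> x; rewrite inE => ->; rewrite orbT.
- by move=> x; rewrite !inE => ->.
Qed.

Lemma reach0 l : reach l [:: 0] 1.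
Proof. by rewrite -mpolyC0; exact: reach_const. Qed.

Lemma reach_op (op : R -> R -> R) l a b s t :
    (forall x y, op x y = x + y) \/ (forall x y, op x y = x * y) ->
  reach l [:: a] s -> reach l [:: b] t -> reach l [:: op a b] (s + t + 1).
Proof.
move=> opE ra rb; apply: reach_trans (reach_cat ra rb) _ => l1 s1 sl.
exists (op a b :: l1); split=> //=; last by rewrite addn1.
- split=> //; constructor 3; exists a, b; split.
  + by apply: sl; rewrite inE eqxx.
  + by apply: sl; rewrite !inE eqxx orbT.
  + by case: opE => ->; [left | right].
- by move=> x; rewrite inE => ->; rewrite orbT.
- by move=> x; rewrite !inE => ->.
Qed.

Lemma reach_add l a b s t :
  reach l [:: a] s -> reach l [:: b] t -> reach l [:: a + b] (s + t + 1).
Proof. by apply: (@reach_op +%R); left. Qed.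

Lemma reach_mul l a b s t :
  reach l [:: a] s -> reach l [:: b] t -> reach l [:: a * b] (s + t + 1).
Proof. by apply: (@reach_op *%R); right. Qed.

Lemma reach_all (I : eqType) (s : seq I) (f : I -> R) l t :
  (forall x, x \in s -> reach l [:: f x] t) ->
  reach l [seq f x | x <- s] (size s * t).
Proof.
elim: s => [|x s IH] h /=; first exact: reach_mem.
rewrite -cat1s mulSn; apply: reach_cat; first by apply: h; rewrite mem_head.
by apply: IH => y ys; apply: h; rewrite inE ys orbT.
Qed.

Lemma reach_bigsum (I : eqType) (s : seq I) (f : I -> R) l t :
  (forall x, x \in s -> reach l [:: f x] t) ->
  reach l [:: \sum_(x <- s) f x] (size s * t.+1 + 1).
Proof.
elim: s => [|x s IH] h /=; first by rewrite big_nil; exact: reach0.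
rewrite big_cons; apply: (@reach_le (t + (size s * t.+1 + 1) + 1)); first lia.
apply: reach_add; first by apply: h; rewrite mem_head.
by apply: IH => y ys; apply: h; rewrite inE ys orbT.
Qed.

Lemma circuit_values_rcons (gs : seq (gate k n)) g :
  circuit_values (rcons gs g) =
  rcons (circuit_values gs) (gate_val (circuit_values gs) g).
Proof. by rewrite /circuit_values foldl_rcons. Qed.

Lemma size_circuit_values (gs : seq (gate k n)) :
  size (circuit_values gs) = size gs.
Proof.
elim/last_ind: gs => [//|gs g IH].
by rewrite circuit_values_rcons !size_rcons IH.
Qed.

Lemma circuit_wf_rcons (gs : seq (gate k n)) g :
  circuit_wf gs -> gate_ok (size gs) g -> circuit_wf (rcons gs g).
Proof.
move=> w h i; rewrite size_rcons ltnS leq_eqVlt => /orP[/eqP->|lt].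
  by rewrite nth_rcons ltnn eqxx.
by rewrite nth_rcons lt; exact: w.
Qed.

(* In-neighbours of a gate must be distinct, so the second operand of a sum or
   product is first copied by a unary + gate. *)
Lemma slp_circuit l : slp l ->
  exists gs, [/\ circuit_wf gs, {subset l <= circuit_values gs}
               & (size gs <= 2 * size l)%N].
Proof.
elim: l => [_|a l IH /= [st /IH[gs [w sub sz]]]]; first by exists [::]; split.
have one g : gate_ok (size gs) g -> gate_val (circuit_values gs) g = a ->
    exists gs', [/\ circuit_wf gs', {subset a :: l <= circuit_values gs'}
               & (size gs' <= 2 * (size l).+1)%N].
  move=> ok va; exists (rcons gs g); split; first exact: circuit_wf_rcons.
    move=> x; rewrite circuit_values_rcons va mem_rcons !inE.
    by case/orP=> [->//|/sub->]; rewrite orbT.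
  by rewrite size_rcons mulnS addSn ltnS (leq_trans sz) // leq_addl.
case: st => [[i aE]|[c aE]|[b [c [bl cl aE]]]].
- by apply: (one (GVar k i)).
- by apply: (one (GConst n c)).
have /(nthP 0)[i ilt bE] := sub _ bl; have /(nthP 0)[j jlt cE] := sub _ cl.
rewrite size_circuit_values in ilt jlt.
pose gs1 := rcons gs (GAdd k n [:: j]).
have w1 : circuit_wf gs1 by apply: circuit_wf_rcons => //=; rewrite jlt.
have v1 : circuit_values gs1 = rcons (circuit_values gs) c.
  by rewrite circuit_values_rcons /= big_seq1 cE.
have s1 : size gs1 = (size gs).+1 by rewrite size_rcons.
have vb : nth 0 (circuit_values gs1) i = b.
  by rewrite v1 nth_rcons size_circuit_values ilt bE.
have vc : nth 0 (circuit_values gs1) (size gs) = c.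
  by rewrite v1 nth_rcons size_circuit_values ltnn eqxx.
have two g : gate_ok (size gs1) g -> gate_val (circuit_values gs1) g = a ->
    exists gs', [/\ circuit_wf gs', {subset a :: l <= circuit_values gs'}
               & (size gs' <= 2 * (size l).+1)%N].
  move=> ok va; exists (rcons gs1 g); split; first exact: circuit_wf_rcons.
    move=> x; rewrite circuit_values_rcons va mem_rcons !inE.
    case/orP=> [->//|/sub h]; apply/orP; right.
    by rewrite v1 mem_rcons inE h orbT.
  by rewrite size_rcons s1 mulnS !addSn !ltnS.
have ok : [&& [:: i; size gs] != [::], uniq [:: i; size gs]
           & all (fun m => (m < size gs1)%N) [:: i; size gs]].
  by rewrite /= s1 inE ltnSn ltnS (ltnW ilt) !andbT neq_ltn ilt.
case: aE => aE.
  by apply: (two (GAdd k n [:: i; size gs])); rewrite //= big_cons big_seq1 vb vc.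
by apply: (two (GMul k n [:: i; size gs])); rewrite //= big_cons big_seq1 vb vc.
Qed.

End StraightLinePrograms.

(** * Linear systems over a domain whose solutions are the multiples of one vector *)

Section LinearAlgebra.

Lemma size_sum_le (S : nzRingType) I (r : seq I) (P : pred I) (F : I -> {poly S}) d :
  (forall i, P i -> size (F i) <= d)%N -> (size (\sum_(i <- r | P i) F i)%R <= d)%N.
Proof.
move=> h; elim/big_ind: _ => // [|p q hp hq]; first by rewrite size_poly0.
by rewrite (leq_trans (size_polyD p q)) // geq_max hp.
Qed.

Lemma size_mul_le (S : nzRingType) (p q : {poly S}) a b :
  (size p <= a)%N -> (size q <= b)%N -> (size (p * q)%R <= (a + b).-1)%N.
Proof. by move=> hp hq; apply: leq_trans (size_polyMleq _ _) _; lia. Qed.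

Lemma size_det_le (S : idomainType) N (M : 'M[{poly S}]_N) d :
  (forall i j, size (M i j) <= d.+1)%N -> (size (\det M) <= (N * d).+1)%N.
Proof.
move=> h; rewrite /determinant; apply: size_sum_le => s _.
rewrite -signr_odd; set b := odd _.
have -> : size ((-1) ^+ b * \prod_i M i (s i)) = size (\prod_i M i (s i)).
  by case: b; rewrite ?expr1 ?mulN1r ?size_polyN // expr0 mul1r.
apply: leq_trans (size_poly_prod_leq _ _) _; rewrite card_ord leq_subLR.
have : (\sum_i size (M i (s i)) <= \sum_(i < N) d.+1)%N.
  by apply: leq_sum => i _; exact: h.
rewrite sum_nat_const card_ord; nia.
Qed.

Lemma common_denominator (R : idomainType) N (u : 'I_N -> {fraction R}) :
  exists d w, d != 0 /\ forall i, u i * FracField.tofrac d = FracField.tofrac (w i).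
Proof.
have ex1 (x : {fraction R}) : exists dw : R * R, dw.1 != 0 /\
    x * FracField.tofrac dw.1 = FracField.tofrac dw.2.
  elim/quotW: x => r; exists (r.2, r.1); split; first exact: denom_ratioP.
  rewrite /GRing.mul /= !piE; apply/eqmodP.
  rewrite /= FracField.equivfE /FracField.mulf.
  by rewrite !numden_Ratio ?oner_eq0 ?mulr1 ?denom_ratioP // mulrC.
have /fin_all_exists[dw dwP] := fun i => ex1 (u i).
exists (\prod_i (dw i).1), (fun i => (dw i).2 * \prod_(j | j != i) (dw j).1).
split=> [|i]; first by apply/prodf_neq0 => i _; case: (dwP i).
by rewrite (bigD1 i) //= !rmorphM /= mulrA (dwP i).2.
Qed.

Variables (R : idomainType) (P Q : finType) (M : P -> Q -> R) (q : Q -> R).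
Variable g0 : Q.
Hypothesis kerM : forall v : Q -> R, (forall p, \sum_g M p g * v g = 0) ->
  exists c, forall g, v g = c * q g.
Hypothesis q_neq0 : q g0 != 0.

Local Notation N := #|[set~ g0]|.

Lemma sum_setC1 (V : zmodType) (F : Q -> V) :
  \sum_g F g = F g0 + \sum_(j < N) F (enum_val j).
Proof.
rewrite (bigD1 g0) //= -[in RHS]big_enum_val.
by congr (_ + _); apply: eq_bigl => g; rewrite !inE.
Qed.

Lemma nonsingular_minor : exists f : 'I_N -> P,
  \det (\matrix_(i, j) M (f i) (enum_val j)) != 0.
Proof.
pose A : 'M[R]_(#|P|, N) := \matrix_(i, j) M (enum_val i) (enum_val j).
pose AF := map_mx (@FracField.tofrac R) A.
have fullA : row_full AF.
  apply/negPn/negP => nf.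
  have : kermx AF^T != 0.
    by rewrite kermx_eq0 /row_free mxrank_tr; exact: nf.
  case/rowV0Pn => u /sub_kermxP uA u0.
  have [d [w [d0 wE]]] := common_denominator (fun j => u 0 j).
  have [w0|] := boolP [forall j, w j == 0].
    case/eqP: u0; apply/rowP => j; rewrite mxE; apply/eqP.
    have := wE j; rewrite (eqP (forallP w0 j)) rmorph0 => /eqP.
    by rewrite mulf_eq0 tofrac_eq0 (negPf d0) orbF.
  case/forallPn => j0 /negP; apply.
  (* The dependency, cleared of denominators, is extended by 0 at [g0]. *)
  pose v g := \sum_(j < N | enum_val j == g) w j.
  have vE j : v (enum_val j) = w j.
    by rewrite /v (eq_bigl (pred1 j)) ?big_pred1_eq // => i; rewrite (inj_eq enum_val_inj).
  have v0 : v g0 = 0.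
    rewrite /v big1 // => j /eqP e; have := enum_valP j.
    by rewrite e !inE eqxx.
  have [|c cE] := kerM (v := v).
    move=> p; rewrite sum_setC1 v0 mulr0 add0r.
    apply/eqP; rewrite -tofrac_eq0 rmorph_sum /=.
    have /matrixP/(_ 0 (enum_rank p)) := uA; rewrite mxE [RHS]mxE => e.
    apply/eqP; transitivity ((u *m AF^T) 0 (enum_rank p) * FracField.tofrac d); last first.
      by rewrite uA mxE mul0r.
    rewrite mxE mulr_suml; apply: eq_bigr => j _.
    by rewrite !mxE enum_rankK vE rmorphM /= -wE mulrCA mulrA.
  have := v0; rewrite cE => /eqP; rewrite mulf_eq0 (negPf q_neq0) orbF => /eqP c0.
  by rewrite -vE cE c0 mul0r.
exists (fun i => enum_val (fullrankfun fullA i)).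
have := fullrowsub_unit fullA; rewrite unitmxE unitfE.
rewrite /AF -map_mxsub det_map_mx tofrac_eq0.
by congr (\det _ != 0); apply/matrixP => i j; rewrite !mxE.
Qed.

Hypothesis Mq : forall p, \sum_g M p g * q g = 0.

Lemma minor_system (f : 'I_N -> P) i :
  \sum_(j < N) M (f i) (enum_val j) * q (enum_val j) = - q g0 * M (f i) g0.
Proof.
by have := Mq (f i); rewrite sum_setC1 => /eqP; rewrite addrC addr_eq0 mulrC mulNr => /eqP.
Qed.

End LinearAlgebra.

(** Cramer's rule gives [D * q g = q g0 * w g], where [w g] is, up to sign, a determinant of order
    [#|Q| - 1] with entries of degree at most 1. As [w] is again a solution, it is a nonzero
    multiple of [q], so [q] has no larger degree. *)
Lemma kernel_size (S : idomainType) (P Q : finType) (M : P -> Q -> {poly S})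
    (q : Q -> {poly S}) (g0 : Q) :
    (forall v : Q -> {poly S}, (forall p, \sum_g M p g * v g = 0) ->
      exists c, forall g, v g = c * q g) ->
    q g0 != 0 -> (forall p, \sum_g M p g * q g = 0) ->
    (forall p g, size (M p g) <= 2)%N ->
  forall g, (size (q g) <= #|Q|)%N.
Proof.
move=> kerM q0 Mq szM; have [f D0] := nonsingular_minor kerM q0.
set M' := (X in \det X) in D0; set D := \det M' in D0.
have cQ : #|Q| = #|[set~ g0]|.+1.
  by rewrite cardsC1 prednK //; apply/card_gt0P; exists g0.
have /fin_all_exists[w wP] : forall g, exists u : {poly S},
    (size u <= #|Q|)%N /\ D * q g = q g0 * u.
  move=> g; have [->|gg0] := eqVneq g g0.
    exists D; rewrite mulrC; split=> //; rewrite cQ -[X in X.+1]muln1.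
    by apply: size_det_le => i j; rewrite mxE.
  have gin : g \in [set~ g0] by rewrite !inE.
  pose j := enum_rank_in gin g.
  have gE : enum_val j = g by rewrite enum_rankK_in.
  pose b : 'cV[{poly S}]_#|[set~ g0]| := \col_i M (f i) g0.
  pose x : 'cV[{poly S}]_#|[set~ g0]| := \col_i q (enum_val i).
  have Mx : M' *m x = (- q g0) *: b.
    apply/colP => i; rewrite !mxE -(minor_system Mq f i).
    by apply: eq_bigr => l _; rewrite !mxE.
  exists (- (\adj M' *m b) j 0); split.
    rewrite size_polyN mxE cQ; apply: size_sum_le => l _.
    rewrite !mxE /cofactor -signr_odd; set e := odd _.
    have szb : (size (M (f l) g0) <= 2)%N by [].
    have szd : (size (\det (row' l (col' j M'))) <= (#|[set~ g0]|.-1 * 1).+1)%N.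
      by apply: size_det_le => s t; rewrite !mxE.
    have Npos : (0 < #|[set~ g0]|)%N by apply: leq_ltn_trans (ltn_ord j).
    apply: leq_trans (size_mul_le (b := 2) _ szb) _.
      rewrite (_ : size _ = size (\det (row' l (col' j M')))); first exact: szd.
      by case: (e); rewrite ?expr1 ?mulN1r ?size_polyN // expr0 mul1r.
    by lia.
  have : \adj M' *m (M' *m x) = D *: x by rewrite mulmxA mul_adj_mx mul_scalar_mx.
  rewrite Mx -scalemxAr => /colP/(_ j); rewrite !mxE gE => <-.
  by rewrite mulNr mulrN.
(* The vector [w] is proportional to [q], so it satisfies the relations once [q g0] is cancelled. *)
have [|c cE] := kerM w.
  move=> p; apply: (mulfI q0); rewrite mulr0.
  transitivity (D * \sum_g M p g * q g); last by rewrite Mq mulr0.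
  by rewrite !mulr_sumr; apply: eq_bigr => g _; rewrite mulrCA -(wP g).2 mulrCA.
have wg0 : w g0 = D by apply: (mulfI q0); rewrite -(wP g0).2 mulrC.
have c0 : c != 0 by apply: contraNneq D0 => c0; rewrite -wg0 cE c0 mul0r.
move=> g; have [->|qg0] := eqVneq (q g) 0; first by rewrite size_poly0.
apply: leq_trans (wP g).1; rewrite cE size_mul //.
by move: c0; rewrite -size_poly_eq0; case: (size c) => // m _; rewrite addSn /= leq_addl.
Qed.

(** * Substitutions: grading by dilation, and points where a determinant does not vanish *)

Section Substitution.

Variables (k : fieldType) (n : nat).
Local Notation R := {mpoly k[n]}.

Definition optX (o : option 'I_n) : R := if o is Some i then 'X_i else 0.

(** At most one variable occurs, as in the entries of basic morphisms; such a form is computed at a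
    cost independent of [n]. *)
Definition affine (p : R) : Prop :=
  exists a b o, p = a%:MP + b%:MP * optX o.

Lemma rmorph_mpolyE (A : comNzRingType) (f : {rmorphism R -> A}) p :
  f p = \sum_(m <- msupp p) f (p@_m)%:MP * \prod_i f 'X_i ^+ m i.
Proof.
rewrite {1}[p]mpolyE rmorph_sum; apply: eq_bigr => m _.
rewrite -mul_mpolyC rmorphM mpolyXE_id rmorph_prod; congr (_ * _).
by apply: eq_bigr => i _; rewrite rmorphXn.
Qed.

Lemma eq_rmorph_mpoly (A : comNzRingType) (f g : {rmorphism R -> A}) :
  (forall c, f c%:MP = g c%:MP) -> (forall i, f 'X_i = g 'X_i) -> f =1 g.
Proof.
move=> hC hX p; rewrite !rmorph_mpolyE; apply: eq_bigr => m _.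
by rewrite hC; congr (_ * _); apply: eq_bigr => i _; rewrite hX.
Qed.

Lemma size_affine (A : idomainType) (f : {rmorphism R -> {poly A}}) p :
    (forall c, size (f c%:MP) <= 1)%N -> (forall i, size (f 'X_i) <= 2)%N ->
  affine p -> (size (f p) <= 2)%N.
Proof.
move=> hC hX [a [b [o ->]]]; rewrite rmorphD rmorphM.
apply: leq_trans (size_polyD _ _) _; rewrite geq_max.
rewrite (leq_trans (hC a)) //=; apply: leq_trans (size_polyMleq _ _) _.
have : (size (f (optX o)) <= 2)%N.
  by case: o => [i|]; rewrite /= ?hX // rmorph0 size_poly0.
by have := hC b; lia.
Qed.

Lemma eq_mmap (A : comNzRingType) (h : {rmorphism k -> A}) (y1 y2 : 'I_n -> A) :
  y1 =1 y2 -> mmap h y1 =1 mmap h y2.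
Proof.
move=> e p; apply: eq_bigr => m _; congr (_ * _); exact: mmap1_eq.
Qed.

(* [dilate p] is p(t x_1, ..., t x_n): its coefficient of t^l is the homogeneous
   component of degree l of p. *)
Definition dilate : R -> {poly R} := mmap (polyC \o @mpolyC n k) (fun i => 'X_i *: 'X).
HB.instance Definition _ := GRing.RMorphism.on dilate.

Lemma dilateC c : dilate c%:MP = (c%:MP)%:P.
Proof. exact: mmapC. Qed.

Lemma dilateX i : dilate 'X_i = 'X_i *: 'X.
Proof. by rewrite /dilate mmapX mmap1U. Qed.

Lemma dilate1 p : (dilate p).[1] = p.
Proof.
rewrite -horner_evalE.
apply: (@eq_rmorph_mpoly _ (horner_eval 1 \o dilate) idfun) => [c|i] /=.
  by rewrite dilateC horner_evalE hornerC.
by rewrite dilateX horner_evalE hornerZ hornerX mulr1.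
Qed.

Lemma dilate0 p : (dilate p)`_0 = (p@_0)%:MP.
Proof.
rewrite -horner_coef0 -horner_evalE.
apply: (@eq_rmorph_mpoly _ (horner_eval 0 \o dilate) (@mpolyC n k \o mcoeff 0)) => [c|i] /=.
  by rewrite dilateC horner_evalE hornerC mcoeffC eqxx mulr1.
by rewrite dilateX horner_evalE hornerZ hornerX mulr0 mcoeffX mnm1_eq0 /= mpolyC0.
Qed.

Lemma dilateXm m : dilate 'X_[m] = 'X_[m] *: 'X^(mdeg m).
Proof.
rewrite /dilate mmapX /mmap1 mpolyXE_id -mul_polyC rmorph_prod mdegE.
rewrite -[X in _ = _ * X]prodrXr -big_split /=; apply: eq_bigr => i _.
by rewrite exprZn -mul_polyC rmorphXn.
Qed.

(** The component of degree [l] is a combination of products of [l] variables, each of which has an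
    image of degree at most 1. *)
Lemma size_dilate_coef (A : idomainType) (f : {rmorphism R -> {poly A}}) p l :
    (forall c, size (f c%:MP) <= 1)%N -> (forall i, size (f 'X_i) <= 2)%N ->
  (size (f ((dilate p)`_l)%R) <= l.+1)%N.
Proof.
move=> hC hX; rewrite {1}[p]mpolyE rmorph_sum coef_sum rmorph_sum.
apply: size_sum_le => m _; rewrite -mul_mpolyC rmorphM /= dilateC dilateXm.
rewrite coefCM coefZ coefXn; case: eqP => [->|_]; last first.
  by rewrite !mulr0 rmorph0 size_poly0.
rewrite mulr1 rmorphM mpolyXE_id rmorph_prod.
apply: leq_trans (size_polyMleq _ _) _.
have : (size (\prod_i f ('X_i ^+ m i))%R <= (mdeg m).+1)%N.
  apply: leq_trans (size_poly_prod_leq _ _) _; rewrite card_ord mdegE leq_subLR.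
  have : (\sum_(i < n) size (f ('X_i ^+ m i))%R <= \sum_(i < n) (m i).+1)%N.
    apply: leq_sum => i _; rewrite rmorphXn.
    by apply: leq_trans (size_poly_exp_leq _ _) _; have := hX i; nia.
  under [X in (_ <= X)%N]eq_bigr do rewrite -addn1.
  by rewrite big_split /= sum_nat_const card_ord; lia.
by have := hC p@_m; lia.
Qed.

Lemma affine0 : affine 0.
Proof. by exists 0, 0, None; rewrite mulr0 addr0 mpolyC0. Qed.

Lemma affineZ c p : affine p -> affine (c%:MP * p).
Proof.
move=> [a [b [o ->]]]; exists (c * a), (c * b), o.
by rewrite mulrDr mulrA !mpolyCM.
Qed.

(** The dilation of [a + b x_i] is [a + b x_i t], so each coefficient is 0, [a] or [b x_i]. *)
Lemma affine_dilate_coef p l l' : affine p -> affine (dilate p * 'X^l')`_l.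
Proof.
move=> [a [b [o ->]]]; rewrite coefMXn; case: leqP => _; last exact: affine0.
rewrite rmorphD rmorphM /= !dilateC coefD coefC coefCM.
have -> : (dilate (optX o))`_(l - l')%N = if (l - l' == 1)%N then optX o else 0.
  case: o => [i|] /=; last by rewrite rmorph0 coef0 if_same.
  by rewrite dilateX coefZ coefX; case: eqP; rewrite ?mulr1 ?mulr0.
case: eqP => [->|_] /=; first by exists a, 0, None; rewrite !mulr0.
case: eqP => _; last by rewrite mulr0 addr0; exact: affine0.
by exists 0, b, o; rewrite mpolyC0.
Qed.

Lemma size_dilateC c : (size (dilate c%:MP) <= 1)%N.
Proof. by rewrite dilateC size_polyC_leq1. Qed.

Lemma size_dilateX i : (size (dilate 'X_i) <= 2)%N.
Proof. by rewrite dilateX (leq_trans (size_scale_leq _ _)) // size_polyX. Qed.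

Section Avoid.
Variables (A : idomainType) (h : {rmorphism k -> A}) (N : nat) (T : 'M[R]_N).
Variable S : seq A.
Hypothesis affT : forall i j, affine (T i j).
Hypotheses (uS : uniq S) (szS : (N < size S)%N).

Let D (y : 'I_n -> A) := \det (map_mx (mmap h y) T).

(** As a function of coordinate [i0] alone, the determinant is a polynomial of degree at most [N],
    nonzero since it does not vanish at [y i0]; it cannot vanish at all of the more than [N]
    elements of [S]. *)
Lemma avoid_coordinate (y : 'I_n -> A) i0 : D y != 0 ->
  exists2 c, c \in S & D (fun i => if i == i0 then c else y i) != 0.
Proof.
move=> D0; pose z i := if i == i0 then 'X else (y i)%:P.
pose th := mmap (polyC \o h) z; pose G := \det (map_mx th T).
have GE c : G.[c] = D (fun i => if i == i0 then c else y i).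
  rewrite -horner_evalE -det_map_mx -map_mx_comp; congr (\det _).
  apply/matrixP => i j; rewrite !mxE.
  apply: (@eq_rmorph_mpoly _ (horner_eval c \o th) (mmap h _)) => [d|l].
    by rewrite /= !mmapC horner_evalE hornerC.
  rewrite /= !mmapX !mmap1U horner_evalE /z.
  by case: eqP => _; rewrite ?hornerX ?hornerC.
have G0 : G != 0.
  apply: contraNneq D0 => G0; have := GE (y i0); rewrite G0 horner0 => e0.
  rewrite (_ : D y = D (fun i => if i == i0 then y i0 else y i)); first by rewrite -e0.
  congr (\det _); apply/matrixP => i j; rewrite !mxE.
  by apply: eq_mmap => l; case: eqVneq => // ->.
have szG : (size G <= N.+1)%N.
  rewrite -[X in X.+1]muln1; apply: size_det_le => i j; rewrite mxE.
  apply: size_affine => // [c|l] /=.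
    by rewrite mmapC size_polyC_leq1.
  rewrite mmapX mmap1U /z; case: eqP => _; first by rewrite size_polyX.
  by rewrite (leq_trans (size_polyC_leq1 _)).
have [/hasP[c cS nr]|/hasPn h0] := boolP (has (fun c => ~~ root G c) S).
  by exists c => //; rewrite -GE.
have : (size S < size G)%N.
  by apply: max_poly_roots => //; apply/allP => c /h0; rewrite negbK.
by move=> lt; have := leq_trans lt szG; rewrite ltnS leqNgt szS.
Qed.

Lemma avoid_point (x : 'I_n -> A) : D x != 0 ->
  exists2 y, (forall i, y i \in S) & D y != 0.
Proof.
move=> D0; suff main s : (s <= n)%N ->
    exists y, (forall i : 'I_n, (i < s)%N -> y i \in S) /\ D y != 0.
  by have [y [yS Dy]] := main n (leqnn n); exists y => // i; exact: yS.
elim: s => [_|s IH lt_sn]; first by exists x; split.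
have [y [yS Dy]] := IH (ltnW lt_sn).
have [c cS Dc] := avoid_coordinate (Ordinal lt_sn) Dy.
exists (fun i => if i == Ordinal lt_sn then c else y i); split=> // i.
rewrite ltnS leq_eqVlt; case: (i =P Ordinal lt_sn) => // ne /orP[/eqP e|/yS //].
by case: ne; apply: val_inj.
Qed.

End Avoid.

(** The powers [t^0, ..., t^N] are distinct over any field, finite or not, so they can serve as the
    values to choose from. The search starts at the generic point, where the determinant is [det T]
    itself. *)
Lemma nonsingular_curve N (T : 'M[R]_N) :
    (forall i j, affine (T i j)) -> \det T != 0 ->
  exists w : 'I_n -> nat, (forall i, w i <= N)%N /\
  \det (map_mx (mmap polyC (fun i => 'X^(w i) : {poly k})) T) != 0.
Proof.
move=> affT T0; pose S := [seq 'X^c : {poly R} | c <- iota 0 N.+1].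
pose h : {rmorphism k -> {poly R}} := polyC \o @mpolyC n k.
have uS : uniq S.
  rewrite map_inj_uniq ?iota_uniq // => a b /(congr1 (fun p : {poly R} => size p)).
  by rewrite !size_polyXn => -[].
have [||y yS Dy] := avoid_point (h := h) affT uS _ (x := fun i => ('X_i)%:P).
- by rewrite size_map size_iota.
- rewrite (_ : map_mx _ T = map_mx polyC T) ?det_map_mx ?polyC_eq0 //.
  apply/matrixP => i j; rewrite !mxE.
  apply: (@eq_rmorph_mpoly _ (mmap h _) polyC) => [c|l] /=; first by rewrite mmapC.
  by rewrite mmapX mmap1U.
have /fin_all_exists[w wP] : forall i, exists m, (m <= N)%N /\ y i = 'X^m.
  by move=> i; have /mapP[m mN ->] := yS i; exists m; rewrite mem_iota in mN.
exists w; split=> [i|]; first by case: (wP i).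
apply: contraNneq Dy => D0; apply/eqP.
(* On the curve the determinant has coefficients in [k]; its image in [R[t]] is the value found
   above. *)
rewrite -[RHS](rmorph0 (map_poly (@mpolyC n k))) -D0 -det_map_mx -map_mx_comp.
congr (\det _); apply/matrixP => i j; rewrite !mxE.
apply: (@eq_rmorph_mpoly _ (mmap h _) (map_poly (@mpolyC n k) \o mmap polyC _)) => [c|l].
  by rewrite /= !mmapC map_polyC.
by rewrite /= !mmapX !mmap1U map_polyXn; case: (wP l).
Qed.

End Substitution.

(** * Division-free expansion of the solution of a system linear in a parameter *)

Section NeumannRecurrence.

Variables (A : idomainType) (N e : nat).
Variables (T : 'M[{poly A}]_N) (z b : 'cV[{poly A}]_N).
Hypotheses (szT : forall i j, (size (T i j) <= 2)%N) (Tz : T *m z = b).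
Hypothesis szz : forall i, (size (z i 0%R) <= e.+1)%N.

Let T0 := map_mx (coefp 0) T.
Let T1 := map_mx (coefp 1) T.
Let d := \det T0.

(** Each coefficient is obtained from the previous one by inverting [T0], at the price of one more
    denominator [d]; the power of [d] clears them all. *)
Definition scaled_coef j : 'cV[A]_N := d ^+ j.+1 *: map_mx (coefp j) z.

Lemma size2_coefM (p q : {poly A}) j : (size p <= 2)%N ->
  (p * q)`_j.+1 = p`_0 * q`_j.+1 + p`_1 * q`_j.
Proof.
move=> sp; rewrite coefM big_ord_recl subn0 big_ord_recl /= subSS subn0.
rewrite big1 ?addr0 // => i _; rewrite [p`_ _]nth_default ?mul0r //.
exact: leq_trans sp _.
Qed.

Lemma scaled_coef0 : scaled_coef 0 = \adj T0 *m map_mx (coefp 0) b.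
Proof.
have -> : map_mx (coefp 0) b = T0 *m map_mx (coefp 0) z.
  apply/colP => i; rewrite -Tz !mxE /= coef_sum; apply: eq_bigr => j _.
  by rewrite !mxE /= coef0M.
by rewrite mulmxA mul_adj_mx mul_scalar_mx /scaled_coef expr1.
Qed.

(** Comparing coefficients in [T z = b] gives [T0 z_(j+1) + T1 z_j = b_(j+1)], which is multiplied
    by [d ^+ j.+1] and by the adjugate of [T0]. *)
Lemma scaled_coefS j : scaled_coef j.+1 =
  \adj T0 *m (d ^+ j.+1 *: map_mx (coefp j.+1) b) + - (\adj T0 *m T1) *m scaled_coef j.
Proof.
have -> : map_mx (coefp j.+1) b =
    T0 *m map_mx (coefp j.+1) z + T1 *m map_mx (coefp j) z.
  apply/colP => i; rewrite -Tz !mxE /= coef_sum -big_split; apply: eq_bigr => l _.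
  by rewrite !mxE /= size2_coefM.
rewrite mulNmx /scaled_coef -!scalemxAr mulmxDr scalerDr !mulmxA mul_adj_mx.
by rewrite mul_scalar_mx scalerA -exprSr addrK.
Qed.

(** All coefficients are brought to the common denominator [d ^+ e.+1]; the value at 1 ends the
    expansion. *)
Lemma sum_scaled_coef i :
  \sum_(j < e.+1) d ^+ (e - j) * scaled_coef j i 0 = d ^+ e.+1 * (z i 0).[1].
Proof.
rewrite (horner_coef_wide _ (szz i)) mulr_sumr; apply: eq_bigr => j _.
rewrite !mxE mulrA -exprD expr1n mulr1 /=; congr (_ ^+ _ * _).
by have := ltn_ord j; lia.
Qed.

End NeumannRecurrence.

(** * Programs solving a nonsingular system of affine forms *)

Section Solver.

Variables (k : fieldType) (n : nat).
Local Notation R := {mpoly k[n]}.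
Implicit Types (l F : seq R).

Lemma reach_allT (I : finType) (f : I -> R) l t :
  (forall x, reach l [:: f x] t) -> reach l [seq f x | x <- enum I] (#|I| * t).
Proof. by move=> h; rewrite cardE; apply: reach_all => x _; exact: h. Qed.

Lemma reach_sumT (I : finType) (f : I -> R) l t :
  (forall x, reach l [:: f x] t) -> reach l [:: \sum_x f x] (#|I| * t.+1 + 1).
Proof. by move=> h; rewrite -big_enum cardE; apply: reach_bigsum => x _; exact: h. Qed.

Lemma reach_optX l o : reach l [:: optX k o] 1.
Proof.
by case: o => [i|]; [exact: reach_var | exact: reach0].
Qed.

Lemma reach_mem1 l a : a \in l -> reach l [:: a] 0.
Proof. by move=> al; apply: reach_mem => x; rewrite inE => /eqP->. Qed.

Lemma reach_mulC l c a t : reach l [:: a] t -> reach l [:: c%:MP * a] (t + 2).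
Proof.
move=> h; apply: (reach_le _ (reach_mul (reach_const c) h)); lia.
Qed.

Lemma subset_catr l1 l2 l : {subset l1 <= l2} -> {subset l1 ++ l <= l2 ++ l}.
Proof. by move=> s x; rewrite !mem_cat => /orP[/s->|->]; rewrite ?orbT. Qed.

Section Recurrence.

Variables (N e v c : nat) (G : 'M[{poly R}]_N) (u B : nat -> 'cV[{poly R}]_N).
Hypotheses (u0 : u 0%N = B 0%N) (uS : forall j, u j.+1 = B j.+1 + G *m u j).
Hypothesis reachG : forall i j m, reach [::] [:: (G i j)`_m] c.
Hypothesis reachB : forall j i m, reach [::] [:: (B j i 0)`_m] c.

Definition recurrence_cost :=
  (N * N * v.+1 * c + e.+1 * (N * v.+1 * (c + (N * (v.+1 * 2 + 1).+1 + 1) + 1)))%N.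

Let CG := [seq (G x.1.1 x.1.2)`_(x.2) | x : 'I_N * 'I_N * 'I_v.+1 <- enum {: 'I_N * 'I_N * 'I_v.+1}].
Let U j := [seq (u j x.1 0)`_(x.2) | x : 'I_N * 'I_v.+1 <- enum {: 'I_N * 'I_v.+1}].

Lemma recurrence_mem j i m : (m <= v)%N -> (u j i 0)`_m \in U j.
Proof.
rewrite -ltnS => mv; apply/mapP; exists (i, Ordinal mv) => //.
by rewrite mem_enum.
Qed.

(** A coefficient of degree at most [v] of a product involves only coefficients of degree at most
    [v] of the factors, so truncation at [v] is consistent. The coefficients [CG] of [G] are shared
    by all steps. *)
Lemma reach_recurrence_step j :
  reach (U j ++ CG) (U j.+1) (N * v.+1 * (c + (N * (v.+1 * 2 + 1).+1 + 1) + 1)).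
Proof.
have -> : (N * v.+1 = #|{: 'I_N * 'I_v.+1}|)%N by rewrite card_prod !card_ord.
apply: reach_allT => -[i m] /=; rewrite uS mxE coefD.
apply: reach_add; first by apply: reach_base (reachB _ _ _).
rewrite mxE coef_sum; apply: (reach_le (t1 := #|'I_N| * (v.+1 * 2 + 1).+1 + 1)).
  by rewrite card_ord.
apply: reach_sumT => i'.
rewrite coefM; apply: (reach_le (t1 := #|'I_m.+1| * 2 + 1)).
  by rewrite card_ord; have := ltn_ord m; lia.
apply: reach_sumT => l; have lm := ltn_ord l; have mv := ltn_ord m.
apply: (reach_mul (s := 0%N) (t := 0%N)); apply: reach_mem1; rewrite mem_cat.
  apply/orP; right; have lv : (l < v.+1)%N by lia.
  by apply/mapP; exists (i, i', Ordinal lv); rewrite ?mem_enum.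
by rewrite recurrence_mem //; lia.
Qed.

Lemma reach_recurrence :
  reach [::] (flatten [seq U j | j <- iota 0 e.+1]) recurrence_cost.
Proof.
have rG : reach [::] CG (N * N * v.+1 * c).
  have -> : (N * N * v.+1 * c = #|{: 'I_N * 'I_N * 'I_v.+1}| * c)%N.
    by rewrite !card_prod !card_ord.
  by apply: reach_allT => x; exact: reachG.
apply: reach_trans rG _; set t := (N * v.+1 * _)%N.
elim: (e) => [|j IH].
  rewrite /= cats0 mul1n /U u0 /t.
  apply: (reach_le (t1 := #|{: 'I_N * 'I_v.+1}| * c)).
    by rewrite card_prod !card_ord leq_mul2l -addnA leq_addr orbT.
  by apply: reach_allT => x; apply: reach_base (reachB _ _ _).
rewrite -addn1 iotaD map_cat flatten_cat mulnDl mul1n /= cats0.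
apply: reach_bind IH _; rewrite add0n.
have sUV : {subset U j <= flatten [seq U i | i <- iota 0 j.+1]}.
  by move=> y yU; apply/flatten_mapP; exists j; rewrite // mem_iota add0n ltnSn.
have := @reach_recurrence_step j; apply: reach_base.
exact: subset_catr.
Qed.

End Recurrence.

(** These are affine forms in one variable over [k[t]]: every coefficient in [t] has constant cost,
    and multiplication by the entries of an adjugate over [k[t]] preserves the class. *)
Definition poly_affine (p : {poly R}) : Prop := exists (a b : {poly k}) o,
  p = map_poly (@mpolyC n k) a + map_poly (@mpolyC n k) b * (optX k o)%:P.

Lemma poly_affineM (a : {poly k}) p :
  poly_affine p -> poly_affine (map_poly (@mpolyC n k) a * p).
Proof.
by move=> [a' [b [o ->]]]; exists (a * a'), (a * b), o; rewrite mulrDr mulrA -!rmorphM.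
Qed.

Lemma reach_poly_affine l p m : poly_affine p -> reach l [:: p`_m] 5.
Proof.
move=> [a [b [o ->]]]; rewrite coefD coefMC !coef_map.
by apply: (reach_le _ (reach_add (reach_const _) (reach_mulC _ (reach_optX o)))).
Qed.

Lemma reach_sum_poly_affine (N : nat) (f : 'I_N -> {poly R}) l m :
  (forall i, poly_affine (f i)) -> reach l [:: (\sum_i f i)`_m] (N * 6 + 1).
Proof.
move=> h; rewrite coef_sum; apply: (reach_le (t1 := #|'I_N| * 6 + 1)).
  by rewrite card_ord.
apply: reach_sumT => i.
exact: reach_poly_affine.
Qed.

Section AffineSystem.

Variables (N e : nat) (T : 'M[R]_N) (b z : 'cV[R]_N).
Hypotheses (affT : forall i j, affine (T i j)) (affb : forall i, affine (b i 0)).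
Hypotheses (T_neq0 : \det T != 0) (Tz : T *m z = b).
Hypothesis szz : forall (A : idomainType) (f : {rmorphism R -> {poly A}}),
  (forall c, size (f c%:MP) <= 1)%N -> (forall i, size (f 'X_i) <= 2)%N ->
  forall i, (size (f (z i 0%R)) <= e.+1)%N.

(** On the curve the entries of [T] have degree at most [N] in [t], hence [det T] at most [N * N];
    this bounds the degree of its power [e.+1], the common denominator. *)
Definition truncation := (N * N * e.+1)%N.

Definition system_cost := (recurrence_cost N e truncation (N * 6 + 1) +
  N * ((e.+1 * (truncation.+1 * 3 + 1).+1 + 1) + 2))%N.

Local Notation lift := (map_poly (@mpolyC n k)).

(* The point x is replaced by y + s (x - y), where y lies on a curve
   (t^w_1, ..., t^w_n) on which det T does not vanish; expanding in powers of s
   only inverts T at y, that is, over k(t), and s = 1 gives back x. *)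
Definition line (w : 'I_n -> nat) : R -> {poly {poly R}} :=
  mmap (polyC \o (polyC \o @mpolyC n k))
    (fun i => ('X^(w i))%:P + (('X_i)%:P - 'X^(w i))%:P * 'X).
HB.instance Definition _ w := GRing.RMorphism.on (line w).

Lemma lineC w c : line w c%:MP = (c%:MP)%:P%:P.
Proof. by rewrite /line mmapC. Qed.

Lemma lineX w i : line w 'X_i = ('X^(w i))%:P + (('X_i)%:P - 'X^(w i))%:P * 'X.
Proof. by rewrite /line mmapX mmap1U. Qed.

Lemma size_lineC w c : (size (line w c%:MP) <= 1)%N.
Proof. by rewrite lineC size_polyC_leq1. Qed.

Lemma size_lineX w i : (size (line w 'X_i) <= 2)%N.
Proof.
rewrite lineX; apply: leq_trans (size_polyD _ _) _; rewrite geq_max.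
rewrite (leq_trans (size_polyC_leq1 _)) //=.
apply: leq_trans (size_polyMleq _ _) _; rewrite size_polyX addn2 /=.
exact: size_polyC_leq1.
Qed.

Lemma line1 w p : (line w p).[1] = p%:P.
Proof.
rewrite -horner_evalE.
apply: (@eq_rmorph_mpoly _ _ _ (horner_eval 1 \o line w) polyC) => [c|i] /=.
  by rewrite lineC horner_evalE hornerC.
by rewrite lineX horner_evalE hornerD hornerMX !hornerC mulr1 addrC subrK.
Qed.

Lemma line0 w p : (line w p)`_0 = lift (mmap polyC (fun i => 'X^(w i) : {poly k}) p).
Proof.
rewrite -horner_coef0 -horner_evalE.
apply: (@eq_rmorph_mpoly _ _ _ (horner_eval 0 \o line w)
         (map_poly (@mpolyC n k) \o mmap polyC _)) => [c|i] /=.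
  by rewrite lineC mmapC map_polyC horner_evalE hornerC.
rewrite lineX mmapX mmap1U map_polyXn horner_evalE hornerD hornerMX !hornerC.
by rewrite mulr0 addr0.
Qed.

Lemma poly_affine_line w p j : affine p -> poly_affine (line w p)`_j.
Proof.
move=> [a [c [o ->]]]; rewrite rmorphD rmorphM /= !lineC coefD coefCM coefC.
have liftC d : lift d%:P = (d%:MP)%:P by rewrite map_polyC.
case: o => [i|] /=; last first.
  exists (if j == 0%N then a%:P else 0), 0, None.
  by rewrite !(rmorph0, coef0, mulr0, mul0r, addr0); case: eqP; rewrite ?liftC ?rmorph0.
rewrite lineX coefD coefC coefCM coefX.
case: j => [|[|j]] /=.
- exists (a%:P + c%:P * 'X^(w i)), 0, None.
  by rewrite rmorphD rmorphM /= !liftC map_polyXn rmorph0 mul0r !mulr0 !addr0.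
- exists (- (c%:P * 'X^(w i))), c%:P, (Some i).
  by rewrite rmorphN rmorphM /= !liftC map_polyXn !add0r mulr1 mulrBr addrC.
- by exists 0, 0, None; rewrite !(rmorph0, mulr0, mul0r, addr0).
Qed.

Lemma reach_system : reach [::] [seq z i 0 | i <- enum 'I_N] system_cost.
Proof.
have [w [wN D0]] := nonsingular_curve affT T_neq0.
set Tk := map_mx _ T in D0; set dk := \det Tk in D0.
pose TT := map_mx (line w) T; pose zz := map_mx (line w) z.
pose bb := map_mx (line w) b.
have TTzz : TT *m zz = bb by rewrite -map_mxM Tz.
have szTT i j : (size (TT i j) <= 2)%N.
  by rewrite mxE; apply: size_affine => //; [exact: size_lineC | exact: size_lineX].
have szzz i : (size (zz i 0%R) <= e.+1)%N.
  by rewrite mxE; apply: szz; [exact: size_lineC | exact: size_lineX].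
have T0E : map_mx (coefp 0) TT = map_mx lift Tk.
  by apply/matrixP => i j; rewrite !mxE /= line0.
have dE : \det (map_mx (coefp 0) TT) = lift dk by rewrite T0E det_map_mx.
pose u := scaled_coef TT zz.
pose adj := \adj (map_mx (coefp 0) TT).
have adjE : adj = map_mx lift (\adj Tk) by rewrite /adj T0E map_mx_adj.
pose G := - (adj *m map_mx (coefp 1) TT).
pose B j := adj *m (lift dk ^+ j *: map_mx (coefp j) bb).
have u0 : u 0%N = B 0%N.
  by have := scaled_coef0 TTzz; rewrite /B expr0 scale1r.
have uS j : u j.+1 = B j.+1 + G *m u j.
  by have := scaled_coefS szTT TTzz j; rewrite dE.
have reachG i j m : reach [::] [:: (G i j)`_m] (N * 6 + 1).
  rewrite mxE mxE -sumrN; apply: reach_sum_poly_affine => l.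
  rewrite adjE !mxE -mulNr -rmorphN; apply: poly_affineM; exact: poly_affine_line.
have reachB j i m : reach [::] [:: (B j i 0)`_m] (N * 6 + 1).
  rewrite mxE; apply: reach_sum_poly_affine => l.
  rewrite adjE !mxE -rmorphXn mulrA -rmorphM; apply: poly_affineM.
  exact: poly_affine_line.
have rU := reach_recurrence e truncation u0 uS reachG reachB.
(* The solution does not involve [t], so the coefficients of [t^v0] in [dk ^+ e.+1 * z i 0] and in
   its expansion can be compared: only the leading coefficient of [dk ^+ e.+1], a nonzero element of
   [k], has to be inverted. *)
pose v0 := (size (dk ^+ e.+1)).-1.
have Dv0 : (dk ^+ e.+1)`_v0 != 0.
  by rewrite -[_`_v0]/(lead_coef _) lead_coef_eq0 expf_neq0.
have v0t : (v0 <= truncation)%N.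
  have szd : (size dk <= (N * N).+1)%N.
    apply: size_det_le => i j; rewrite mxE; have [a [c [o ->]]] := affT i j.
    rewrite rmorphD rmorphM /= !mmapC; apply: leq_trans (size_polyD _ _) _.
    rewrite geq_max (leq_trans (size_polyC_leq1 _)) //=.
    apply: leq_trans (size_mul_le (b := N.+1) (size_polyC_leq1 _) _) _ => //.
    case: o => [l|] /=; last by rewrite rmorph0 size_poly0.
    by rewrite mmapX mmap1U size_polyXn ltnS.
  have predW p q : (p <= q -> p.-1 <= q.-1)%N by lia.
  apply: leq_trans (predW _ _ (size_poly_exp_leq dk e.+1)) _.
  by rewrite leq_mul2r /= (predW _ _ szd).
rewrite /system_cost; apply: reach_trans rU _.
set F := flatten _; rewrite -[N in (N * _)%N]card_ord.
apply: reach_allT => i; set c := (dk ^+ e.+1)`_v0 in Dv0.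
have -> : z i 0 = c^-1%:MP * \sum_(j < e.+1) \sum_(l < v0.+1)
    ((dk ^+ (e - j))`_l)%:MP * (u j i 0)`_(v0 - l)%N.
  have := sum_scaled_coef TT szzz i; rewrite !mxE line1 dE => /(congr1 (coefp v0)) /=.
  rewrite -rmorphXn coefMC coef_map coef_sum -/c => e1.
  transitivity (c^-1%:MP * (c%:MP * z i 0)).
    by rewrite mulrA -mpolyCM mulVf ?mpolyC1 ?mul1r.
  rewrite -e1; congr (_ * _); apply: eq_bigr => j _.
  rewrite -rmorphXn coefM; apply: eq_bigr => l _; by rewrite coef_map.
apply: reach_mulC.
apply: (reach_le (t1 := (#|'I_e.+1| * (#|'I_v0.+1| * 3 + 1).+1 + 1)%N)).
  by rewrite !card_ord leq_add2r leq_mul2l /=; lia.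
apply: reach_sumT => j; apply: reach_sumT => l.
apply: (reach_mulC _ (t := 0)); apply: reach_mem1; apply/flatten_mapP; exists (j : nat).
  by rewrite mem_iota add0n ltn_ord.
by apply: recurrence_mem; lia.
Qed.

End AffineSystem.

End Solver.

(** * Cost bounds by powers of a single quantity *)

Section PowerBounds.

Variable X : nat.
Hypothesis X_ge : (10 <= X)%N.

Lemma leq_powD a b i j :
  (a <= X ^ i -> b <= X ^ j -> a + b <= X ^ (maxn i j).+1)%N.
Proof.
move=> ha hb; have hX : (0 < X)%N by lia.
have := leq_pexp2l hX (leq_maxl i j); have := leq_pexp2l hX (leq_maxr i j).
by rewrite expnS; nia.
Qed.

Lemma leq_powM a b i j : (a <= X ^ i -> b <= X ^ j -> a * b <= X ^ (i + j))%N.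
Proof. by move=> ha hb; rewrite expnD leq_mul. Qed.

Lemma leq_powS a i : (a <= X ^ i -> a.+1 <= X ^ i.+1)%N.
Proof. by move=> ha; have := expn_gt0 X i; rewrite expnS; nia. Qed.

Lemma leq_pow1 a : (a <= 10 -> a <= X ^ 1)%N.
Proof. by rewrite expn1 => h; apply: leq_trans X_ge. Qed.

Lemma reach_coefs_cost N e m : (N <= X ^ 2 -> e.+1 <= X -> m <= X ->
  system_cost N e + m * m * 1 <= X ^ 50)%N.
Proof.
rewrite -{2 3}[X]expn1 => hN he hm.
(* The exponent is left open: following the shape of the cost determines it, and it is compared with
   50 at the end. *)
have he1 := ltnW he; refine (leq_trans (n := X ^ ?[d]) _ _).
  rewrite /system_cost /recurrence_cost /truncation.
  repeat first [exact: hN | exact: he | exact: he1 | exact: hm | exact: leq_pow1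
    | eapply leq_powD | eapply leq_powM | eapply leq_powS].
by apply: leq_pexp2l => //; lia.
Qed.

End PowerBounds.

(** * Computing the homogeneous components of a universal solution vector *)

Section UniversalVector.

Variables (k : fieldType) (n : nat).
Local Notation R := {mpoly k[n]}.
Variables (P Q : finType) (B : P -> Q -> R) (q : Q -> R) (g0 : Q).
Hypothesis affB : forall p g, affine (B p g).
Hypothesis kerB : forall v : Q -> {poly R},
  (forall p, \sum_g dilate (B p g) * v g = 0) ->
  exists c, forall g, v g = c * dilate (q g).
Hypothesis Bq : forall p, \sum_g B p g * q g = 0.
Hypothesis q0 : (q g0)@_0 != 0.

Lemma dilate_neq0 : dilate (q g0) != 0.
Proof.
apply: contraNneq q0 => e; have := dilate0 (q g0); rewrite e coef0.
by move/eqP; rewrite eq_sym mpolyC_eq0.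
Qed.

Lemma dilate_relation p : \sum_g dilate (B p g) * dilate (q g) = 0.
Proof. by under eq_bigr do rewrite -rmorphM; rewrite -rmorph_sum Bq rmorph0. Qed.

Lemma size_relation p g : (size (dilate (B p g)) <= 2)%N.
Proof. by apply: size_affine => //; [exact: size_dilateC | exact: size_dilateX]. Qed.

Lemma size_dilate_le g : (size (dilate (q g)) <= #|Q|)%N.
Proof.
exact: (kernel_size (M := fun p g => dilate (B p g)) (q := fun g => dilate (q g))
  kerB dilate_neq0 dilate_relation size_relation).
Qed.

Section Toeplitz.

Variables (e : nat) (g1 : Q).
Hypothesis size_g1 : size (dilate (q g1)) = e.+1.
Hypothesis size_max : forall g, (size (dilate (q g)) <= e.+1)%N.

(** Unknown [(g, l)] stands for the coefficient of [t^l] in entry [g], equation [(p, l)] for that of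
    [t^l] in relation [p]. Relations have degree at most 1 in [t], whence the range [e.+2]. *)
Definition toeplitz (p : P * 'I_e.+2) (g : Q * 'I_e.+1) : R :=
  (dilate (B p.1 g.1) * 'X^(g.2))`_(p.2).

Let vec (g : Q * 'I_e.+1) : R := (dilate (q g.1))`_(g.2).

Definition pack (v : Q * 'I_e.+1 -> R) g := \poly_(l < e.+1) v (g, inord l).

Lemma toeplitzE v p l :
  \sum_g toeplitz (p, l) g * v g = (\sum_g dilate (B p g) * pack v g)`_l.
Proof.
rewrite coef_sum.
transitivity (\sum_g \sum_l' toeplitz (p, l) (g, l') * v (g, l')).
  by rewrite pair_bigA; apply: eq_bigr => -[].
apply: eq_bigr => g _; rewrite /pack poly_def mulr_sumr coef_sum.
by apply: eq_bigr => l' _; rewrite -scalerAr coefZ mulrC inord_val.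
Qed.

Lemma pack_vec g : pack vec g = dilate (q g).
Proof.
apply/polyP => l; rewrite coef_poly; case: ltnP => h; first by rewrite /vec /= inordK.
by rewrite nth_default // (leq_trans (size_max g)).
Qed.

Lemma toeplitz_vec p : \sum_g toeplitz p g * vec g = 0.
Proof.
case: p => p l; rewrite toeplitzE; under eq_bigr do rewrite pack_vec.
by rewrite dilate_relation coef0.
Qed.

(** A solution packs into a vector over [R[t]] of degree at most [e], which is a multiple of the
    dilated [q]; since entry [g1] already has degree [e], the multiplier is constant in [t]. *)
Lemma toeplitz_kernel (v : Q * 'I_e.+1 -> R) :
  (forall p, \sum_g toeplitz p g * v g = 0) -> exists c, forall g, v g = c * vec g.
Proof.
move=> h; have [|c cE] := kerB (v := pack v).
  move=> p; apply/polyP => l; rewrite coef0.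
  have [lt|ge] := ltnP l e.+2; first by rewrite -(toeplitzE v p (Ordinal lt)) h.
  rewrite nth_default //; apply: leq_trans ge; apply: size_sum_le => g _.
  exact: (size_mul_le (size_relation p g) (size_poly _ _)).
have szc : (size c <= 1)%N.
  have [->|c0] := eqVneq c 0; first by rewrite size_poly0.
  have := size_poly e.+1 (fun l => v (g1, inord l)); rewrite -/(pack v g1) cE.
  rewrite size_mul //; last by rewrite -size_poly_eq0 size_g1.
  by rewrite size_g1 addnS -[X in (_ <= X)%N -> _]add1n leq_add2r.
exists c`_0 => -[g l]; transitivity (pack v g)`_l.
  by rewrite coef_poly ltn_ord inord_val.
by rewrite cE {1}(size1_polyC szc) coefCM.
Qed.

Lemma reach_vec :
  exists2 N, (N <= #|Q| * e.+1)%N &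
  reach [::] [seq vec g | g <- enum [set~ (g0, ord0)]] (system_cost N e).
Proof.
have v0E : vec (g0, ord0) = ((q g0)@_0)%:MP by rewrite /vec dilate0.
have v0 : vec (g0, ord0) != 0 by rewrite v0E mpolyC_eq0.
have [f D0] := nonsingular_minor toeplitz_kernel v0.
set T := (X in \det X) in D0.
(* The fixed unknown is the constant term of [q g0], an element of [k], so the right-hand side stays
   affine. *)
pose b := \col_i (- vec (g0, ord0) * toeplitz (f i) (g0, ord0)).
pose z : 'cV[R]_#|[set~ (g0, ord0 : 'I_e.+1)]| := \col_i vec (enum_val i).
have affT i j : affine (T i j) by rewrite mxE; apply: affine_dilate_coef.
have affb i : affine (b i 0).
  by rewrite mxE v0E -mpolyCN; apply: affineZ; apply: affine_dilate_coef.
have Tz : T *m z = b.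
  apply/colP => i; rewrite !mxE -(minor_system (g0 := (g0, ord0)) toeplitz_vec f i).
  by apply: eq_bigr => j _; rewrite !mxE.
have szz (A : idomainType) (h : {rmorphism R -> {poly A}}) :
    (forall c, size (h c%:MP) <= 1)%N -> (forall i, size (h 'X_i) <= 2)%N ->
    forall i, (size (h (z i 0%R)) <= e.+1)%N.
  move=> hC hX i; rewrite mxE; apply: leq_trans (size_dilate_coef _ _ hC hX) _.
  exact: ltn_ord.
exists #|[set~ (g0, ord0 : 'I_e.+1)]|.
  by rewrite (leq_trans (max_card _)) // card_prod card_ord.
apply: reach_sub (reach_system affT affb D0 Tz szz) => x /mapP[g gin ->].
apply/mapP; rewrite mem_enum in gin; exists (enum_rank_in gin g).
  by rewrite mem_enum.
by rewrite mxE enum_rankK_in.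
Qed.

End Toeplitz.

Definition coefs := [seq (dilate (q x.1))`_(x.2) | x : Q * 'I_#|Q| <- enum {: Q * 'I_#|Q|}].

Lemma reach_coefs : exists2 d, (d <= (#|Q| + 10) ^ 50)%N & reach [::] coefs d.
Proof.
case: (@arg_maxnP _ g0 xpredT (fun g => size (dilate (q g))) isT) => g1 _ g1max.
have sz1 : (0 < size (dilate (q g1)))%N.
  by apply: leq_trans (g1max g0 isT); rewrite lt0n size_poly_eq0 dilate_neq0.
set e := (size (dilate (q g1))).-1.
have szg1 : size (dilate (q g1)) = e.+1 by rewrite prednK.
have szmax g : (size (dilate (q g)) <= e.+1)%N by rewrite -szg1; exact: g1max.
have [N leN rN] := reach_vec szg1 szmax.
have leE : (e.+1 <= #|Q|)%N by rewrite -szg1 size_dilate_le.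
exists (system_cost N e + #|{: Q * 'I_#|Q|}| * 1)%N.
  have leQ : (#|Q| <= #|Q| + 10)%N by apply: leq_addr.
  rewrite card_prod card_ord; apply: reach_coefs_cost => //; first exact: leq_addl.
    by rewrite (leq_trans leN) // -mulnn leq_mul // (leq_trans leE).
  exact: leq_trans leE _.
apply: reach_trans rN _.
set L := [seq _ | _ <- _]; have memL g (l : 'I_e.+1) : (g, l) != (g0, ord0) ->
    (dilate (q g))`_l \in L.
  by move=> ne; apply/mapP; exists (g, l) => //; rewrite mem_enum !inE.
move: L memL => L memL; apply: reach_allT => -[g l] /=.
(* Components above degree [e] vanish and the fixed one is a constant; all others belong to [L]. *)
have [le|lt] := leqP e.+1 l.
  by rewrite nth_default; [apply: reach0 | apply: leq_trans (szmax g) le].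
have [gE|ne] := eqVneq (g, Ordinal lt) (g0, ord0).
  have -> : (dilate (q g))`_l = ((q g0)@_0)%:MP.
    by case: gE => -> lE; rewrite lE dilate0.
  exact: reach_const.
by apply: (reach_le (t1 := 0%N)) => //; apply: reach_mem1; apply: (memL g (Ordinal lt)).
Qed.

End UniversalVector.

(** * Membership in lists without decidable equality *)

Section ListMembership.

Lemma In_map (A B : Type) (f : A -> B) s y :
  List.In y (map f s) <-> exists2 x, List.In x s & f x = y.
Proof.
elim: s => [|a s IH] /=; first by split=> // -[].
split=> [[<-|/IH[x xs <-]]|[x [->|xs] fx]].
- by exists a => //; left.
- by exists x => //; right.
- by left.
- by right; apply/IH; exists x.
Qed.

Lemma In_cat (A : Type) (s t : seq A) y :
  List.In y (s ++ t) <-> List.In y s \/ List.In y t.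
Proof. by elim: s => [|a s IH] /=; tauto. Qed.

Lemma In_flatten (A : Type) (ss : seq (seq A)) y :
  List.In y (flatten ss) <-> exists2 s, List.In s ss & List.In y s.
Proof.
elim: ss => [|s ss IH] /=; first by split=> // -[].
rewrite In_cat IH; split=> [[ys|[t tss yt]]|[t [->|tss] yt]].
- by exists s => //; left.
- by exists t => //; right.
- by left.
- by right; exists t.
Qed.

Lemma In_mem (T : eqType) (s : seq T) x : List.In x s <-> x \in s.
Proof.
elim: s => [|a s IH] //=; rewrite inE IH; split=> [[->|->]|/orP[/eqP->|]].
- by rewrite eqxx.
- by rewrite orbT.
- by left.
- by right.
Qed.

Lemma In_tnth (A : Type) (s : seq A) x :
  List.In x s -> exists i, tnth (in_tuple s) i = x.
Proof.
elim: s => [|a s IH] //= [<-|/IH[i <-]]; first by exists ord0.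
by exists (lift ord0 i); rewrite !(tnth_nth a).
Qed.

Lemma tnth_In (A : Type) (s : seq A) i : List.In (tnth (in_tuple s) i) s.
Proof.
case: s i => [[]//|a s] i; rewrite (tnth_nth a); case: i => i /= lt.
elim: s a i lt => [|b t IH] a [|i] //= lt; [by left| by left |].
by right; have := IH b i lt; rewrite (set_nth_default b).
Qed.

Lemma In_has (A : Type) (p : pred A) s : has p s -> exists2 x, List.In x s & p x.
Proof.
elim: s => //= a s IH /orP[pa|/IH[x xs px]]; first by exists a => //; left.
by exists x => //; right.
Qed.

End ListMembership.

(** * Linear maps from proofs of linearity, and restriction of scalars *)

Section LinearOf.
Variables (R : pzRingType) (U V : lmodType R) (f : U -> V).
Definition linear_of (lf : linear f) := f.
HB.instance Definition _ lf := GRing.isLinear.Build R U V *:%R (linear_of lf) lf.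
End LinearOf.

(** An alias of [A] on which [R] acts through [f], so that the universal property of colimits also
    yields maps to [R[t]] through [dilate] and to [k] through evaluation at 0. *)
Definition restrict (R A : comNzRingType) (f : {rmorphism R -> A}) : Type := A.

Section RestrictionOfScalars.
Variables (R A : comNzRingType) (f : {rmorphism R -> A}).
Local Notation M := (restrict f).

HB.instance Definition _ := GRing.Zmodule.copy M A.

Definition restrict_scale (r : R) (a : M) : M := f r * (a : A).

Fact restrict_scaleA r s a : restrict_scale r (restrict_scale s a) = restrict_scale (r * s) a.
Proof. by rewrite /restrict_scale rmorphM mulrA. Qed.
Fact restrict_scale1 : left_id 1 restrict_scale.
Proof. by move=> a; rewrite /restrict_scale rmorph1 mul1r. Qed.
Fact restrict_scaleDr : right_distributive restrict_scale +%R.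
Proof. by move=> r a b; exact: mulrDr. Qed.
Fact restrict_scaleDl a : {morph restrict_scale^~ a : r s / r + s}.
Proof. by move=> r s; rewrite /restrict_scale rmorphD; exact: mulrDl. Qed.

HB.instance Definition _ := GRing.Zmodule_isLmodule.Build R M
  restrict_scaleA restrict_scale1 restrict_scaleDr restrict_scaleDl.

Lemma restrict_linear (U : lmodType R) (h : U -> A) :
  (forall a x y, h (a *: x + y) = f a * h x + h y) -> linear (h : U -> M).
Proof. by []. Qed.

Lemma restrict_linearZ (U : lmodType R) (h : {linear U -> M}) a x :
  h (a *: x) = f a * (h x : A) :> A.
Proof. exact: (linearZZ h). Qed.

End RestrictionOfScalars.

(** * Reduction of every colimit to the initial diagram *)

Section Colimits.

Variables (k : fieldType) (n : nat) (D : colimComp k n).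
Local Notation R := {mpoly k[n]}.
Local Notation obj := (@ccobj k n D).
Local Notation V0 := 'I_(ccm D).
Local Notation V1 := 'I_(ccs D).
Hypothesis valid : cc_valid D.

Lemma In_edges_upto i (e : edge obj) : List.In e (edges_upto D i) <->
  List.In e (E0_edges D) \/ exists2 j : V1, (j < i)%N & List.In e (step_edges j).
Proof.
rewrite In_cat In_flatten; split=> -[]; [by left| | by left|].
  case=> s /In_map[j /In_mem]; rewrite mem_filter => /andP[ji _] <- ?.
  by right; exists j.
case=> j ji ej; right; exists (step_edges j) => //.
by apply/In_map; exists j => //; apply/In_mem; rewrite mem_filter ji mem_enum.
Qed.

Lemma cocone_base (i : V1) e : List.In e (ccE0 D) -> inl (projT1 e).1 \in ccJ i ->
  inl (projT1 e).2 \in ccJ i -> forall x,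
  ccc i (inl (projT1 e).2) (basic_map (projT2 e) x) = ccc i (inl (projT1 e).1) x.
Proof.
case: valid => _ [_ [colim _]]; have [coc _] := colim i => eE sJ tJ x.
pose e' : edge obj := existT (fun p : ccV D * ccV D => {linear ccobj p.1 -> ccobj p.2})
  (inl (projT1 e).1, inl (projT1 e).2) (basic_map (projT2 e)).
have he : List.In e' (edges_upto D i).
  by apply/In_edges_upto; left; apply/In_map; exists e.
exact: (coc e' he sJ tJ x).
Qed.

Lemma cocone_step (i j : V1) v : inr j \in ccJ i -> v \in ccJ j -> forall x,
  ccc i (inr j) (ccc j v x) = ccc i v x.
Proof.
case: valid => _ [bef [colim constr]]; have [coc _] := colim i => jJ vJ x.
have ji : (j < i)%N := bef i _ jJ.
pose e' : edge obj := existT (fun p : ccV D * ccV D => {linear ccobj p.1 -> ccobj p.2})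
  (v, inr j) (ccc j v).
have he : List.In e' (edges_upto D i).
  apply/In_edges_upto; right; exists j => //; apply/In_map; exists v => //.
  by apply/In_mem; rewrite mem_enum.
exact: (coc e' he (subsetP (constr _ _ ji jJ) _ vJ) jJ x).
Qed.

(** By constructivity, an earlier vertex [v_j] in [J_i] has [J_j] inside [J_i], so induction shows
    that the composites of [h] and [h'] with the leg from [L_j] agree; the uniqueness part of the
    universal property then concludes. *)
Lemma colimit_uniq (i : V1) (M : lmodType R) (h h' : {linear ccL i -> M}) :
  (forall u, inl u \in ccJ i -> forall x, h (ccc i (inl u) x) = h' (ccc i (inl u) x)) ->
  forall y, h y = h' y.
Proof.
have [b le_ib] := ubnP (nat_of_ord i).
elim: b => // b IH in i le_ib h h' * => hh'.
case: valid => _ [bef [colim constr]]; have [coc univ] := colim i.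
have [|g [_ gU]] := univ M (fun v => h \o ccc i v).
  by move=> e eI sJ tJ x /=; congr (h _); exact: coc.
have h'g v : v \in ccJ i -> forall x, h' (ccc i v x) = (h \o ccc i v) x.
  case: v => [u|j] vJ x /=; first by rewrite hh'.
  have ji : (j < i)%N := bef i _ vJ.
  apply: (IH j _ (h' \o ccc i (inr j)) (h \o ccc i (inr j))).
    by apply: leq_trans ji _; rewrite -ltnS.
  move=> u uJ y /=; rewrite cocone_step // hh' //.
  exact: (subsetP (constr _ _ ji vJ)).
by move=> y; rewrite (gU h) // (gU h').
Qed.

(* By constructivity, the colimit over [J_i] is the colimit of the restriction
   of the initial diagram to the initial vertices of [J_i]. *)
Lemma colimit_exists (i : V1) (M : lmodType R)
    (d : forall u : V0, {linear 'rV[R]_(ccdim u) -> M}) :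
    (forall e, List.In e (ccE0 D) ->
      inl (projT1 e).1 \in ccJ i -> inl (projT1 e).2 \in ccJ i ->
      forall x, d (projT1 e).2 (basic_map (projT2 e) x) = d (projT1 e).1 x) ->
  exists h : {linear ccL i -> M},
    forall u, inl u \in ccJ i -> forall x, h (ccc i (inl u) x) = d u x.
Proof.
have [b le_ib] := ubnP (nat_of_ord i).
elim: b => // b IH in i le_ib * => dcoc.
case: valid => _ [bef [colim constr]]; have [coc univ] := colim i.
(* Induction provides the maps on the earlier colimits in [J_i]; outside [J_i] the zero map is a
   placeholder. *)
have /fin_all_exists[hh hhP] : forall j : V1, exists h : {linear ccL j -> M},
    inr j \in ccJ i -> forall u, inl u \in ccJ j -> forall x,
    h (ccc j (inl u) x) = d u x.
  move=> j; have [jJ|jJ] := boolP (inr j \in ccJ i); last by exists (\0).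
  have ji : (j < i)%N := bef i _ jJ; have sub := subsetP (constr _ _ ji jJ).
  have [||h hP] := IH j; last by exists h.
    by apply: leq_trans ji _; rewrite -ltnS.
  by move=> e eE sJ tJ; apply: dcoc => //; apply: sub.
pose dd (v : ccV D) : {linear obj v -> M} :=
  match v return {linear obj v -> M} with inl u => d u | inr j => hh j end.
have [|h [hP _]] := univ M dd; last first.
  by exists h => u uJ x; rewrite (hP (inl u)).
move=> e /In_edges_upto[/In_map[e0 e0E <-]|[j ji /In_map[v /In_mem vJ <-]]] sJ tJ x.
  exact: dcoc.
rewrite mem_enum in vJ; rewrite /etgt /emap /= in tJ *.
case: v vJ sJ x => [u|l] vJ sJ x /=; first exact: hhP.
have lj : (l < j)%N := bef j _ vJ; have sub := subsetP (constr _ _ lj vJ).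
(* Compatibility along an edge between two colimits is tested on the initial vertices below its
   source. *)
apply: (colimit_uniq (h := hh j \o ccc j (inr l)) (h' := hh l)) => u uJ y /=.
by rewrite cocone_step // !hhP //; apply: sub.
Qed.

End Colimits.

(** * Generators and relations of a colimit isomorphic to R *)

Section FreeColimit.

Variables (k : fieldType) (n : nat) (D : colimComp k n).
Local Notation R := {mpoly k[n]}.
Local Notation V0 := 'I_(ccm D).
Local Notation V1 := 'I_(ccs D).
Local Notation E0 := (in_tuple (ccE0 D)).
Hypothesis valid : cc_valid D.

Lemma basic_dim a b (e : basic k n a b) : (a <= 2)%N && (b <= 2)%N.
Proof. by case: e. Qed.

Lemma ccdim_le2 (u : V0) : (ccdim u <= 2)%N.
Proof.
case: valid => /(_ u)/In_has[[[s t] e] _ /=] + _.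
by have /andP[hs ht] := basic_dim e; case/orP => /eqP <-.
Qed.

(** Every initial vertex is an end of some edge, and an edge has two ends. *)
Lemma ccm_le : (ccm D <= size (ccE0 D) * 2)%N.
Proof.
pose ends := [seq (projT1 e).1 | e <- ccE0 D] ++ [seq (projT1 e).2 | e <- ccE0 D].
have -> : (size (ccE0 D) * 2 = size ends)%N by rewrite size_cat !size_map muln2 addnn.
rewrite -[X in (X <= _)%N]card_ord cardE; apply: uniq_leq_size; first exact: enum_uniq.
move=> u _; case: valid => /(_ u) + _; rewrite /ends mem_cat.
elim: (ccE0 D) => //= e s IH; rewrite !inE ![u == _]eq_sym.
case/orP => [/orP[]->|/IH/orP[]->]; by rewrite ?orbT.
Qed.

Definition gens : finType := {u : V0 & 'I_(ccdim u)}.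
Definition gen (u : V0) (j : 'I_(ccdim u)) : gens := Tagged (fun u => 'I_(ccdim u)) j.

Lemma card_gens : (#|gens| <= 4 * size (ccE0 D))%N.
Proof.
rewrite card_tagged sumnE big_map big_enum /=.
apply: (@leq_trans (\sum_(u < ccm D) 2)).
  by apply: leq_sum => u _; rewrite card_ord ccdim_le2.
by rewrite sum_nat_const card_ord; have := ccm_le; lia.
Qed.

Lemma affine_nat m : affine (m%:R : R).
Proof. by exists m%:R, 0, None; rewrite mulr0 addr0 mpolyC_nat. Qed.

Lemma affine_natB m (p : R) : affine p -> affine (m%:R - p).
Proof.
move=> [a [b [o ->]]]; exists (m%:R - a), (- b), o.
by rewrite mpolyCB mpolyCN mulNr opprD addrA mpolyC_nat.
Qed.

Lemma affine_basic_mx a b (e : basic k n a b) i j : affine (basic_mx e i j).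
Proof.
case: e i j => [v|c|||||] i j; rewrite !mxE //=;
  try first [exact: affine_nat | exact: (affine_nat 1) | exact: affine0].
- by rewrite !ord1 eqxx mulr1n; exists 0, 1, (Some v); rewrite mpolyC0 add0r mpolyC1 mul1r.
- by rewrite !ord1 eqxx mulr1n; exists c, 0, None; rewrite mulr0 addr0.
Qed.

Variables (i : V1) (psi : {linear 'rV[R]_1 -> ccL i}) (psi' : {linear ccL i -> 'rV[R]_1}).
Hypotheses (psiK : cancel psi psi') (psi'K : cancel psi' psi).

Local Notation inJ u := (inl u \in ccJ i).

Definition rels : finType :=
  ({p : 'I_(size (ccE0 D)) & 'I_(ccdim (projT1 (tnth E0 p)).1)} + gens)%type.

(* Generators of vertices outside [J_i] are killed, so that the set of
   generators does not depend on [i]. *)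
Definition rel_coef (r : rels) (g : gens) : R :=
  match r with
  | inl r => let e := tnth E0 (tag r) in
      if inJ (projT1 e).1 && inJ (projT1 e).2 then
        (g == gen (tagged r))%:R
        - \sum_l (g == gen l)%:R * basic_mx (projT2 e) (tagged r) l
      else 0
  | inr g' => if inJ (tag g') then 0 else (g == g')%:R
  end.

(** The generators [gen l] are distinct, so at most one matrix entry contributes to a given
    coefficient. *)
Lemma affine_rel r g : affine (rel_coef r g).
Proof.
case: r => [[p j]|g'] /=; case: ifP => _;
  try first [exact: affine_nat | exact: affine0].
apply: affine_natB; have [/existsP[l /eqP gl]|/existsPn nl] 
  := boolP [exists l : 'I_(ccdim (projT1 (tnth E0 p)).2), g == gen l].
  rewrite (bigD1 l) //= -gl eqxx mul1r big1 ?addr0; first exact: affine_basic_mx.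
  move=> l' ne; rewrite gl /gen eq_Tagged /= eq_sym.
  by rewrite (negPf (ne : l' != l)) mul0r.
by rewrite big1 => [|l _]; [exact: affine0 | rewrite (negPf (nl l)) mul0r].
Qed.

Section Sum.
Variables (A : comNzRingType) (f : {rmorphism R -> A}) (v : gens -> A).

Lemma sum_delta g : \sum_g' f (g' == g)%:R * v g' = v g.
Proof.
rewrite (bigD1 g) //= eqxx rmorph1 mul1r big1 ?addr0 // => g' /negPf->.
by rewrite rmorph0 mul0r.
Qed.

Lemma sum_edge_rel p (j : 'I_(ccdim (projT1 (tnth E0 p)).1)) :
  inJ (projT1 (tnth E0 p)).1 -> inJ (projT1 (tnth E0 p)).2 ->
  \sum_g f (rel_coef (inl (Tagged _ j)) g) * v g =
  v (gen j) - \sum_l f (basic_mx (projT2 (tnth E0 p)) j l) * v (gen l).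
Proof.
move=> sJ tJ; rewrite /rel_coef /= sJ tJ /=.
under eq_bigr do rewrite rmorphB mulrBl.
rewrite sumrB sum_delta; congr (_ - _).
transitivity (\sum_g \sum_l
    f ((g == gen l)%:R * basic_mx (projT2 (tnth E0 p)) j l) * v g).
  by apply: eq_bigr => g _; rewrite rmorph_sum mulr_suml.
rewrite exchange_big; apply: eq_bigr => l _.
by rewrite -[v (gen l)]sum_delta mulr_sumr; apply: eq_bigr => g _; rewrite rmorphM mulrA [X in X * _]mulrC.
Qed.

Lemma sum_gen_rel g : ~~ inJ (tag g) -> \sum_g' f (rel_coef (inr g) g') * v g' = v g.
Proof. by move=> /negPf h; rewrite /rel_coef h sum_delta. Qed.

End Sum.

Lemma linear_row_sum (S : pzRingType) (M : lmodType S) a (h : {linear 'rV[S]_a -> M}) x :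
  h x = \sum_j x 0 j *: h (delta_mx 0 j).
Proof.
rewrite {1}[x]row_sum_delta linear_sum; apply: eq_bigr => j _; exact: linearZ.
Qed.

(** This is the vector [q] of the quotient map from the free module on [gens] to [L_i], read in [R]
    through [psi']. *)
Definition coord (g : gens) : R :=
  if inJ (tag g) then psi' (ccc i (inl (tag g)) (delta_mx 0 (tagged g))) 0 0 else 0.

Lemma coordE u x : inJ u ->
  psi' (ccc i (inl u) x) 0 0 = \sum_j x 0 j * coord (gen j).
Proof.
move=> uJ; have /= -> := linear_row_sum (psi' \o ccc i (inl u)) x; rewrite summxE.
by apply: eq_bigr => j _; rewrite mxE /coord /= uJ.
Qed.

Lemma rel_coord r : \sum_g rel_coef r g * coord g = 0.
Proof.
case: r => [[p j]|g'].
  have [/andP[sJ tJ]|nJ] := boolP (inJ (projT1 (tnth E0 p)).1 && inJ (projT1 (tnth E0 p)).2).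
    rewrite (sum_edge_rel idfun coord j sJ tJ); apply/eqP; rewrite subr_eq0; apply/eqP.
    have := cocone_base valid (tnth_In p) sJ tJ (delta_mx 0 j) => /(congr1 psi').
    move/matrixP/(_ 0 0); rewrite coordE // => e; rewrite {1}/coord /= sJ -e.
    by apply: eq_bigr => l _; rewrite /= -rowE mxE.
  by rewrite big1 // => g _; rewrite /rel_coef /= (negPf nJ) mul0r.
have [gJ|gJ] := boolP (inJ (tag g')).
  by rewrite big1 // => g _; rewrite /rel_coef gJ mul0r.
by rewrite (sum_gen_rel idfun coord gJ) /coord (negPf gJ).
Qed.

(** A solution over [A] is a cocone from the initial vertices of [J_i] to [A] as an [R]-module. It
    factors through [L_i], isomorphic to [R], and a linear map on [R] is determined by the image of
    1, which is the multiplier [c]. *)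
Lemma rel_kernel (A : comNzRingType) (f : {rmorphism R -> A}) (v : gens -> A) :
    (forall r, \sum_g f (rel_coef r g) * v g = 0) ->
  exists c, forall g, v g = c * f (coord g).
Proof.
move=> hv.
pose d u (x : 'rV[R]_(ccdim u)) : A := \sum_j f (x 0 j) * v (gen j).
have fin u : linear (d u : _ -> restrict f).
  apply: restrict_linear => a x y; rewrite mulr_sumr -big_split; apply: eq_bigr => j _.
  by rewrite !mxE rmorphD rmorphM mulrDl mulrA.
have [|h hP] := colimit_exists valid (i := i) (d := fun u => linear_of (fin u)).
  move=> e eE; have [p pe] := In_tnth eE; subst e => sJ tJ x.
  rewrite /= /linear_of /d.
  transitivity (\sum_l \sum_j f (x 0 j) *
      (f (basic_mx (projT2 (tnth E0 p)) j l) * v (gen l))).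
    apply: eq_bigr => l _; rewrite mxE rmorph_sum mulr_suml; apply: eq_bigr => j _.
    by rewrite rmorphM mulrA.
  rewrite exchange_big; apply: eq_bigr => j _; rewrite -mulr_sumr; congr (_ * _).
  have := sum_edge_rel f v j sJ tJ; rewrite hv => /esym/eqP.
  by rewrite subr_eq0 => /eqP.
exists (h (psi 1%:M) : A) => -[u j]; rewrite /coord /=.
have [uJ|uJ] := boolP (inJ u); last first.
  have := sum_gen_rel f v (g := gen j) uJ; rewrite hv => <-.
  by rewrite rmorph0 mulr0.
have := hP u uJ (delta_mx 0 j); rewrite /= /linear_of /d (bigD1 j) //=.
rewrite mxE !eqxx rmorph1 mul1r big1 ?addr0; last first.
  by move=> j' ne; rewrite mxE (negPf ne) andbF rmorph0 mul0r.
move=> <-; set y := ccc _ _ _.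
have -> : y = psi' y 0 0 *: psi 1%:M.
  rewrite -linearZ /= scalemx1 -{1}(psi'K y); congr (psi _).
  by apply/rowP => l; rewrite !ord1 mxE eqxx mulr1n.
by rewrite restrict_linearZ mulrC; congr (_ * f _); rewrite linearZ psiK !mxE mulr1.
Qed.

(** Otherwise evaluation at the origin, as a map from [L_i] to [k], would vanish on all generators
    and hence be zero, although it sends [psi 1%:M] to 1. *)
Lemma coord_origin : exists g, (coord g)@_0 != 0.
Proof.
have [/existsP //|/existsPn h0] := boolP [exists g, (coord g)@_0 != 0]; exfalso.
pose ev : {rmorphism R -> k} := mcoeff 0.
pose h (y : ccL i) := ev (psi' y 0 0).
have hlin : linear (h : ccL i -> restrict ev).
  by apply: restrict_linear => a x y; rewrite /h linearP !mxE rmorphD rmorphM.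
have := colimit_uniq valid (h := linear_of hlin) (h' := \0).
move=> /(_ _ (psi 1%:M)) /=; rewrite /linear_of /h psiK mxE rmorph1.
move=> e; suff /eqP : (1 : k) = 0 by rewrite oner_eq0.
apply: e => u uJ x; rewrite coordE // rmorph_sum big1 // => j _.
rewrite rmorphM (_ : ev (coord (gen j)) = 0) ?mulr0 //.
exact/eqP/negPn/h0.
Qed.

Lemma size_coord g : (size (dilate (coord g)) <= #|gens|)%N.
Proof.
have [g0 q0] := coord_origin.
exact: (size_dilate_le affine_rel (rel_kernel (f := @dilate k n)) rel_coord q0).
Qed.

Lemma reach_coord : exists2 d, (d <= (#|gens| + 10) ^ 50)%N & reach [::] (coefs coord) d.
Proof.
have [g0 q0] := coord_origin.
exact: (reach_coefs affine_rel (rel_kernel (f := @dilate k n)) rel_coord q0).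
Qed.

End FreeColimit.

(** * Isomorphisms with R, and recovering a polynomial from homogeneous components *)

Lemma linear_inverse (S : pzRingType) (U V : lmodType S) (h : {linear U -> V}) :
  bijective h -> exists h' : {linear V -> U}, cancel h h' /\ cancel h' h.
Proof.
case=> g gK Kg; have lg : linear g by apply: can2_linear gK Kg.
by exists (linear_of lg).
Qed.

Section Computed.

Variables (k : fieldType) (n : nat).
Local Notation R := {mpoly k[n]}.

Lemma mpoly_unit_const (p p' : R) : p * p' = 1 -> p = (p@_0)%:MP.
Proof.
by rewrite mulrC => /mpoly_intro_unit/andP[/eqP].
Qed.

(* Comparing the traces of the two composites of an isomorphism R ~ R^a with its
   inverse gives 1 = a in k, which for a <= 2 forces a = 1. *)
Lemma free_iso_const a (phi : {linear 'rV[R]_1 -> 'rV[R]_a}) :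
  (a <= 2)%N -> bijective phi -> exists c : 'I_a -> k, forall l, phi 1%:M 0 l = (c l)%:MP.
Proof.
move=> a2 /linear_inverse[phi' [phiK phi'K]].
have inv1 : lin1_mx phi *m lin1_mx phi' = 1%:M.
  by apply/row_matrixP => i; rewrite row_mul !rowE !mul_rV_lin1 mulmx1 phiK.
have inv2 : lin1_mx phi' *m lin1_mx phi = 1%:M.
  by apply/row_matrixP => i; rewrite row_mul !rowE !mul_rV_lin1 mulmx1 phi'K.
have a1 : a = 1%N.
  have := mxtrace_mulC (lin1_mx phi) (lin1_mx phi').
  rewrite inv1 inv2 !mxtrace1.
  case: (a) a2 => [|[|[|b]]] //= _ /eqP; first by rewrite oner_eq0.
  by rewrite -subr_eq0 -opprB oppr_eq0 -natrB //= oner_eq0.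
subst a; exists (fun l => (phi 1%:M 0 l)@_0) => l.
apply: (@mpoly_unit_const _ (phi' 1%:M 0 0)).
have d1 : delta_mx 0 0 = 1%:M :> 'rV[R]_1 by apply/rowP => m; rewrite !ord1 !mxE.
have /matrixP/(_ 0 0) := inv1; rewrite mxE big_ord1 [RHS]mxE eqxx !mxE d1 => e.
by rewrite (ord1 l); exact: e.
Qed.

Lemma reach_affine l (p : R) : affine p -> reach l [:: p] 5.
Proof.
move=> [a [b [o ->]]].
exact: reach_add (reach_const a) (reach_mulC b (reach_optX o)).
Qed.

Lemma reach_dilate_sum l (p : R) A :
  (size (dilate p) <= A)%N -> (forall m, (m < A)%N -> (dilate p)`_m \in l) ->
  reach l [:: p] (A * 1 + 1).
Proof.
move=> sz h; rewrite -[p]dilate1 (horner_coef_wide _ sz).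
apply: (reach_le (t1 := #|'I_A| * 1 + 1)); first by rewrite card_ord.
apply: reach_sumT => m; rewrite expr1n mulr1; apply: reach_mem1; exact: h.
Qed.

Lemma size_factor (S : idomainType) (P F : {poly S}) :
  P != 0 -> (size F <= size (P * F)%R)%N.
Proof.
move=> P0; have [->|F0] := eqVneq F 0; first by rewrite size_poly0.
rewrite size_mul //; move: P0; rewrite -size_poly_eq0.
by case: (size P) => // m _; rewrite addSn leq_addl.
Qed.

Lemma quotient_coef (S : comNzRingType) (P F : {poly S}) u m : u * P`_0 = 1 ->
  F`_m = u * ((P * F)`_m + \sum_(l < m) - 1 * (P`_l.+1 * F`_(m - l.+1)%N)).
Proof.
move=> uP; rewrite coefM big_ord_recl subn0 -addrA -big_split /=.
rewrite big1 ?addr0; first by rewrite mulrA uP mul1r.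
by move=> j _; rewrite mulN1r subrr.
Qed.

(* Division of power series, as p has an invertible constant term. *)
Lemma reach_quotient l (p q f : R) A :
    p@_0 != 0 -> q = p * f -> (size (dilate q) <= A)%N ->
    (forall m, (m < A)%N -> (dilate p)`_m \in l /\ (dilate q)`_m \in l) ->
  reach l [:: f] (A * (A * 4 + 4) + (A * 1 + 1)).
Proof.
move=> p0 qE szq memA; set F := dilate f.
have QE : dilate q = dilate p * F by rewrite qE rmorphM.
have dp0 : dilate p != 0.
  apply: contraNneq p0 => e; have := dilate0 p; rewrite e coef0.
  by move/eqP; rewrite eq_sym mpolyC_eq0.
have szF : (size F <= A)%N.
  by apply: leq_trans szq; rewrite QE; exact: size_factor.
have FE m : F`_m = ((p@_0)^-1)%:MP *
    ((dilate q)`_m + \sum_(l < m) (- 1)%:MP * ((dilate p)`_l.+1 * F`_(m - l.+1)%N)).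
  rewrite QE mpolyCN mpolyC1; apply: quotient_coef.
  by rewrite dilate0 -mpolyCM mulVf ?mpolyC1.
have step m : (m <= A)%N -> reach l [seq F`_j | j <- iota 0 m] (m * (A * 4 + 4)).
  elim: m => [|m IH] lt; first exact: reach_mem.
  rewrite -addn1 iotaD map_cat mulnDl mul1n add0n /=.
  apply: reach_bind (IH (ltnW lt)) _; set L := _ ++ l.
  have memF j : (j < m)%N -> F`_j \in L.
    by move=> jm; rewrite mem_cat; apply/orP; left; apply: map_f; rewrite mem_iota.
  have meml x : x \in l -> x \in L by move=> xl; rewrite mem_cat xl orbT.
  move: L memF meml => L memF meml; rewrite FE.
  apply: (reach_le (t1 := 0 + (#|'I_m| * 4 + 1) + 1 + 2)).
    by rewrite card_ord; lia.
  apply: reach_mulC; apply: reach_add.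
    by apply: reach_mem1; apply: meml; case: (memA m lt).
  apply: reach_sumT => j; apply: (reach_mulC _ (t := 1)).
  apply: (reach_mul (s := 0%N) (t := 0%N)); apply: reach_mem1.
    by apply: meml; have [] := memA j.+1 (leq_ltn_trans (ltn_ord j) lt).
  by apply: memF; have := ltn_ord j; lia.
apply: reach_trans (step A (leqnn A)) _; apply: reach_dilate_sum => // m mA.
by apply: map_f; rewrite mem_iota.
Qed.

End Computed.

(** The two costs are those of an edge into a colimit from an initial vertex and from an earlier
    colimit. *)
Lemma reach_step_cost X A d d' :
  (10 <= X -> A <= X -> d <= X ^ 50 -> d' <= X ^ 50 ->
  d + (2 * ((A * 1 + 1) + 2).+1 + 1) <= X ^ 60 /\
  d + d' + (A * (A * 4 + 4) + (A * 1 + 1)) <= X ^ 60)%N.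
Proof.
rewrite -{2}[X]expn1 => hX hA hd hd'; split;
  [refine (leq_trans (n := X ^ ?[e1]) _ _) | refine (leq_trans (n := X ^ ?[e2]) _ _)];
  try by repeat first [exact: hA | exact: hd | exact: hd' | exact: leq_pow1
    | eapply leq_powD | eapply leq_powM | eapply leq_powS].
all: by apply: leq_pexp2l => //; lia.
Qed.

(** * The computed edge: between initial vertices, or into a colimit *)

Section Theorem5p7.

Variables (k : fieldType) (n : nat) (D : colimComp k n) (f : {mpoly k[n]}).
Local Notation R := {mpoly k[n]}.
Hypothesis valid : cc_valid D.
Local Notation X := (10 * (cc_cost D).+1)%N.

Lemma gens_le : (#|gens D| + 10 <= X)%N.
Proof. by have := card_gens valid; rewrite /cc_cost; lia. Qed.

Lemma mem_coefs (i : 'I_(ccs D)) (psi' : {linear ccL i -> 'rV[R]_1}) g m :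
  (m < #|gens D|)%N -> (dilate (coord psi' g))`_m \in coefs (coord psi').
Proof.
by move=> lt; apply/mapP; exists (g, Ordinal lt); rewrite ?mem_enum.
Qed.

(** Both isomorphisms are given by constant vectors, so [f] is, up to a nonzero scalar, a
    combination of at most two entries of a basic matrix. *)
Lemma reach_initial_edge (e : edge (@ccobj k n D))
    (phi : {linear 'rV[R]_1 -> ccobj (esrc e)}) (psi : {linear 'rV[R]_1 -> ccobj (etgt e)}) :
    List.In e (E0_edges D) -> bijective phi -> bijective psi ->
    (forall r, emap (phi r) = psi (r *m f%:M)) ->
  exists2 t, (t <= X ^ 60)%N & reach [::] [:: f] t.
Proof.
move=> /In_map[[[u w] b] _ E]; subst e; rewrite /esrc /etgt /emap /= in phi psi *.
move=> phi_bij psi_bij com.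
have [c cE] := free_iso_const (ccdim_le2 valid u) phi_bij.
have [c' c'E] := free_iso_const (ccdim_le2 valid w) psi_bij.
have com1 l : \sum_j (c j)%:MP * basic_mx b j l = f * (c' l)%:MP.
  have := com 1%:M; rewrite mul1mx -[f%:M]scalemx1 linearZ => /matrixP/(_ 0 l).
  by rewrite !mxE c'E => <-; apply: eq_bigr => j _; rewrite cE.
(* The vector [psi 1%:M] is nonzero because [psi] is injective. *)
have [l c'l] : exists l, c' l != 0.
  apply/existsP; rewrite -[X in is_true X]negbK; apply/negP => /existsPn h0.
  have [h hK _] := psi_bij; have : psi 1%:M = psi 0.
    rewrite linear0; apply/rowP => l; rewrite c'E mxE.
    by have /negPn/eqP -> := h0 l; rewrite mpolyC0.
  move=> /(congr1 h); rewrite !hK => /matrixP/(_ 0 0); rewrite !mxE => /eqP.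
  by rewrite oner_eq0.
exists (2 * 8 + 1 + 2)%N; first by rewrite (leq_trans _ (leq_pexp2l _ (_ : (2 <= 60)%N))); lia.
have -> : f = ((c' l)^-1)%:MP * \sum_j (c j)%:MP * basic_mx b j l.
  by rewrite com1 mulrCA -mpolyCM mulVf ?mpolyC1 ?mulr1.
apply: reach_mulC; apply: (reach_le (t1 := #|'I_(ccdim u)| * 8 + 1)).
  by rewrite card_ord leq_add2r leq_mul2r ccdim_le2.
apply: reach_sumT => j; apply: (reach_mulC _ (t := 5)); apply: reach_affine.
exact: affine_basic_mx.
Qed.

Lemma reach_step_edge (j : 'I_(ccs D)) (v : ccV D)
    (phi : {linear 'rV[R]_1 -> ccobj v}) (psi : {linear 'rV[R]_1 -> ccL j}) :
    v \in ccJ j -> bijective phi -> bijective psi ->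
    (forall r, ccc j v (phi r) = psi (r *m f%:M)) ->
  exists2 t, (t <= X ^ 60)%N & reach [::] [:: f] t.
Proof.
move=> vJ phi_bij psi_bij com.
have [psi' [psiK psi'K]] := linear_inverse psi_bij.
have [d dX rd] := reach_coord valid psiK psi'K.
have szq := size_coord valid psiK psi'K.
have {}dX : (d <= X ^ 50)%N by rewrite (leq_trans dX) // leq_exp2r // gens_le.
have X10 : (10 <= X)%N by rewrite leq_pmulr.
have AX : (#|gens D| <= X)%N by rewrite (leq_trans _ gens_le) // leq_addr.
case: v vJ phi phi_bij com => [u|i] vJ phi phi_bij com.
  (* From an initial vertex, [f] is the image in [R] of a constant vector, hence a constant
     combination of entries of [coord psi']. *)
  have [c cE] := free_iso_const (ccdim_le2 valid u) phi_bij.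
  have fE : f = \sum_l (c l)%:MP * coord psi' (gen l).
    have := congr1 psi' (com 1%:M); rewrite psiK mul1mx => /matrixP/(_ 0 0).
    rewrite coordE // [RHS]mxE eqxx mulr1n => <-.
    by apply: eq_bigr => l _; rewrite cE.
  have [tX _] := reach_step_cost X10 AX dX dX.
  exists (d + (2 * ((#|gens D| * 1 + 1) + 2).+1 + 1))%N; first exact: tX.
  apply: reach_trans rd _; rewrite fE.
  apply: (reach_le (t1 := #|'I_(ccdim u)| * ((#|gens D| * 1 + 1) + 2).+1 + 1)).
    by rewrite card_ord leq_add2r leq_mul2r ccdim_le2 // orbT.
  apply: reach_sumT => l; apply: reach_mulC; apply: reach_dilate_sum => // m.
  exact: mem_coefs.
have [phi' [phiK phi'K]] := linear_inverse phi_bij.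
have [d' dX' rd'] := reach_coord valid phiK phi'K.
have {}dX' : (d' <= X ^ 50)%N by rewrite (leq_trans dX') // leq_exp2r // gens_le.
have [g0 p0] := coord_origin valid phiK.
have g0J : inl (tag g0) \in ccJ i.
  by apply: contraNT p0 => /negPf h; rewrite /coord h mcoeff0.
(* The leg from the vertex of [g0] to [L_j] factors through [L_i], where the generator [g0] is
   [coord phi' g0] times the basis element, and the edge multiplies by [f]. *)
have qE : coord psi' g0 = coord phi' g0 * f.
  case: valid => _ [bef [_ constr]]; have ij : (i < j)%N := bef j _ vJ.
  rewrite /coord g0J (subsetP (constr _ _ ij vJ) _ g0J).
  rewrite -(cocone_step valid vJ g0J); set y := ccc i _ _.
  have yE : y = phi (phi' y 0 0)%:M by rewrite -mx11_scalar phi'K.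
  by rewrite {1}yE com psiK -scalar_mxM mxE eqxx mulr1n.
have [_ tX] := reach_step_cost X10 AX dX dX'.
exists (d + d' + (#|gens D| * (#|gens D| * 4 + 4) + (#|gens D| * 1 + 1)))%N; first exact: tX.
apply: reach_trans (reach_cat rd rd') _; apply: (reach_quotient p0 qE (szq g0)) => m mA.
by split; rewrite mem_cat; apply/orP; [right | left]; exact: mem_coefs.
Qed.

End Theorem5p7.

(* There is a fixed polynomial bound C * (c+1)^d (uniform in k, n, f) *)
Theorem theorem5p7 :
  exists C d : nat,
  forall (k : fieldType) (n : nat) (f : {mpoly k[n]}) (D : colimComp k n),
    cc_valid D -> cc_computes D f ->
    exists gs : seq (gate k n),
      circuit_wf gs /\ f \in circuit_values gs /\
      (circuit_size gs <= C * (cc_cost D).+1 ^ d)%N.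
Proof.
suff [d main] : exists d, forall (k : fieldType) (n : nat) (f : {mpoly k[n]})
    (D : colimComp k n), cc_valid D -> cc_computes D f ->
    exists2 t, (t <= (10 * (cc_cost D).+1) ^ d)%N & reach [::] [:: f] t.
  (* The factor 2 pays for the copying gates, and [10 ^ d] comes from the base
     [10 * (cc_cost D).+1]. *)
  exists (2 * 10 ^ d)%N, d => k n f D valid comp.
  have [t tX r] := main k n f D valid comp.
  have [//|//|l [sl _ fl szl]] := r [::].
  have [gs [wf sub sz]] := slp_circuit sl; exists gs; split=> //; split.
    by apply: sub; apply: fl; rewrite mem_head.
  apply: leq_trans sz _; rewrite -mulnA -expnMn leq_mul2l /=.
  exact: leq_trans szl tX.
exists 60 => k n f D valid [e [eE [_ [phi [psi [phi_bij [psi_bij com]]]]]]].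
case/In_edges_upto: eE => [eE|[j _ /In_map[v /In_mem vJ E]]].
  exact: (reach_initial_edge valid eE phi_bij psi_bij com).
subst e; rewrite mem_enum in vJ.
exact: (reach_step_edge valid vJ phi_bij psi_bij com).
Qed.
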